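(* Let $C_0,\alpha,c_1>0$ be constants. (i) If $d_n \le C_0 n^{-\alpha}$ for every $n\ge 1$, then for every $1\le n\le \mathcal N$ and every $\varphi\in F$, $\|\varphi-\mathcal J_n[\varphi]\|_{\mathcal X}\le (1+\Lambda_n)\,C_0\,\beta_n\,n^{-\alpha}$, where $\beta_1 := 2(1+\eta^{-1})$ and, for $n\ge 2$ written as $n=4\ell+k$ with $\ell\in\{0,1,\dots\}$, $k\in\{0,1,2,3\}$, $$\beta_n := \frac{1}{\prod_{i=1}^{\ell_2}\gamma_{\ell_1-\lceil k/4\rceil+i}^{1/\ell_2}}\sqrt{2\ell_2\,\beta_{\ell_1}}\,(2\sqrt2)^{\alpha},\qquad \ell_1=2\ell+\lfloor 2k/3\rfloor,\quad \ell_2=2(\ell+\lceil k/4\rceil).$$ (ii) If $C_0\ge 1$ and $d_n\le C_0e^{-c_1n^{\alpha}}$ for every $n\ge 1$, then for every $1\le n\le\mathcal N$ and every $\varphi\in F$, $\|\varphi-\mathcal J_n[\varphi]\|_{\mathcal X}\le (1+\Lambda_n)\,C_0\,\beta_n\,e^{-c_2n^{\alpha}}$, where $c_2:=c_1 2^{-2\alpha-1}$, $\beta_1:=2(1+\eta^{-1})$ and, for $n\ge 2$, $$\beta_n:=\sqrt2\,\frac{1}{\prod_{i=1}^{2\lfloor n/2\rfloor}\gamma_i^{1/(2\lfloor n/2\rfloor)}}\,\sqrt n .$$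
   Context: Setting. $\mathcal X$ is a real Banach space of functions defined over a domain $\overline\Omega\subset\mathbb R^d$ or $\mathbb C^d$, with norm $\|\cdot\|_{\mathcal X}$ and dual $\mathcal X'$; $F\subset\mathcal X$ is compact with $\|\varphi\|_{\mathcal X}\le 1$ for all $\varphi\in F$; $\mathcal N\in\{1,2,\dots\}\cup\{\infty\}$ is such that $\dim\operatorname{span}F>\mathcal N$ (infinite-dimensional if $\mathcal N=\infty$); indices $n$ are always finite integers. $\Sigma\subset\mathcal X'$ is a dictionary such that: (P1) $\|\sigma\|_{\mathcal X'}=1$ for all $\sigma\in\Sigma$; (P2) if $\varphi\in\operatorname{span}F$ and $\sigma(\varphi)=0$ for all $\sigma\in\Sigma$, then $\varphi=0$; (P3) for all $\varphi\in\operatorname{span}F$ the set $\{\sigma(\varphi):\sigma\in\Sigma\}\subset\mathbb R$ is closed. GEIM weak greedy algorithm. Fix $\eta\in(0,1]$. Let $F_0\subset F_1\subset\cdots$ be subsets of $F$ and $\widetilde\Sigma_0\subset\widetilde\Sigma_1\subset\cdots$ subsets of $\Sigma$ (all finite if $\eta<1$; $F_n=F$ for all $n$ if $\eta=1$) such that $\widetilde\Sigma_n$ satisfies (P2) and (P3) with $F$ replaced by $F_n$. Choose $\varphi_0\in\operatorname{argmax}_{\varphi\in F_0}\|\varphi\|_{\mathcal X}$ and $\sigma_0\in\operatorname{argmax}_{\sigma\in\widetilde\Sigma_0}|\sigma(\varphi_0)|$. For $1\le n\le\mathcal N$ put $X_n=\operatorname{span}\{\varphi_0,\dots,\varphi_{n-1}\}$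 and let $\mathcal J_n:\mathcal X\to X_n$ be the linear operator for which $\mathcal J_n[\varphi]$ is the unique element of $X_n$ with $\sigma_i(\mathcal J_n[\varphi])=\sigma_i(\varphi)$, $i=0,\dots,n-1$ (this is well posed and $\dim X_n=n$); then choose $\varphi_n\in\operatorname{argmax}_{\varphi\in F_n}\|\varphi-\mathcal J_n[\varphi]\|_{\mathcal X}$ and $\sigma_n\in\operatorname{argmax}_{\sigma\in\widetilde\Sigma_n}|\sigma(\varphi_n-\mathcal J_n[\varphi_n])|$. The sets $F_n$ are such that $\max_{F_0}\|\varphi\|_{\mathcal X}\ge\eta\max_F\|\varphi\|_{\mathcal X}$ and $\max_{\varphi\in F_n}\|\varphi-\mathcal J_n[\varphi]\|_{\mathcal X}\ge\eta\max_{\varphi\in F}\|\varphi-\mathcal J_n[\varphi]\|_{\mathcal X}$ for $1\le n\le\mathcal N$. Notation. $\Lambda_n=\sup_{\varphi\in\mathcal X\setminus\{0\}}\|\mathcal J_n[\varphi]\|_{\mathcal X}/\|\varphi\|_{\mathcal X}$ (Lebesgue constant) and $\gamma_n=\eta/(1+\Lambda_n)$ for $1\le n\le\mathcal N$. The Kolmogorov $n$-width is $d_n=d_n(F,\mathcal X)=\inf_{Y\subset\mathcal X,\ \dim Y\le n}\ \max_{u\in F}\ \inf_{v\in Y}\|u-v\|_{\mathcal X}$ ($Y$ linear subspaces). *)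

(* Defs.v *)
From HB Require Import structures.
From mathcomp Require Import all_boot all_order all_algebra.
From mathcomp Require Import all_classical all_reals all_analysis.
From mathcomp Require Import zify.

Set Implicit Arguments.
Unset Strict Implicit.
Unset Printing Implicit Defensive.

Import Order.TTheory GRing.Theory Num.Theory.
Import numFieldNormedType.Exports.

Local Open Scope classical_set_scope.
Local Open Scope ring_scope.

(* The bound N ranges over {1, 2, ...} together with infinity, coded by None. *)
Definition index_le (n : nat) (N : option nat) : bool :=
  if N is Some M then (n <= M)%N else true.

Definition argmax {T : Type} {R : realType} (A : set T) (f : T -> R) : set T :=
  [set x | A x /\ forall y, A y -> f y <= f x].

Section LinearAlgebra.
Context {R : realType} {V : lmodType R}.

Definition lspan (A : set V) : set V :=
  [set x | exists (n : nat) (a : 'I_n -> R) (v : 'I_n -> V),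
     (forall i, A (v i)) /\ x = \sum_(i < n) a i *: v i].

Definition lin_indep (n : nat) (v : 'I_n -> V) : Prop :=
  forall a : 'I_n -> R, \sum_(i < n) a i *: v i = 0 -> forall i, a i = 0.

(* dim Y >= n, for a linear subspace Y of possibly infinite dimension *)
Definition dim_ge (Y : set V) (n : nat) : Prop :=
  exists v : 'I_n -> V, (forall i, Y (v i)) /\ lin_indep v.

Definition dim_le (Y : set V) (n : nat) : Prop := ~ dim_ge Y n.+1.

Definition dim_gt (Y : set V) (N : option nat) : Prop :=
  if N is Some M then dim_ge Y M.+1 else forall n, dim_ge Y n.

End LinearAlgebra.

Section Norms.
Context {R : realType}.

(* For V != 0 and f linear and bounded, the set below is nonempty and bounded,
   so that the real-valued sup is the true supremum. *)
Definition opnorm {V W : normedModType R} (f : V -> W) : R :=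
  sup [set `|f x| / `|x| | x in [set x : V | x != 0]].

Definition cont_dual (V : normedModType R) : set (V -> R^o) :=
  [set s | linear s /\ continuous s].

Definition dist_to {V : normedModType R} (Y : set V) (u : V) : R :=
  inf [set `|u - v| | v in Y].

Definition kolmogorov_width {V : normedModType R} (F : set V) (n : nat) : R :=
  inf [set sup [set dist_to Y u | u in F] |
        Y in [set Y : set V | submod_closed (mem Y) /\ dim_le Y n]].

End Norms.

Section GEIM.
Context {R : realType} {X : completeNormedModType R}.

(* property (P2) of the set of functionals S relative to F *)
Definition separating (S : set (X -> R^o)) (F : set X) : Prop :=
  forall f, lspan F f -> (forall s, S s -> s f = 0) -> f = 0.

(* property (P3) of the set of functionals S relative to F *)
Definition closed_values (S : set (X -> R^o)) (F : set X) : Prop :=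
  forall f, lspan F f -> closed ([set s f | s in S] : set R).

Record dictionary (S : set (X -> R^o)) (F : set X) : Prop := {
  dictionary_dual : S `<=` @cont_dual R X ;
  dictionary_norm1 : forall s, S s -> opnorm s = 1 ;
  dictionary_separating : separating S F ;
  dictionary_closed : closed_values S F }.

(* X_n = span {phi_0, ..., phi_(n-1)} *)
Definition geim_space (phi : nat -> X) (n : nat) : set X :=
  lspan [set phi i | i in `I_n].

(* J_n[f] is the unique g in X_n with sigma_i(g) = sigma_i(f) for all i < n.
   That such a g exists and is unique is not built in: for n <= N it follows
   from geim_run below together with 0 < eta and dim (span F) > N. *)
Definition geim_interp (phi : nat -> X) (sigma : nat -> X -> R^o) (n : nat)
    (f : X) : X :=
  xget 0 [set g | geim_space phi n g /\
                  forall i, (i < n)%N -> sigma i g = sigma i f].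

(* phi and sigma are produced by the weak greedy algorithm, with parameter eta,
   from the sets Fs n (subsets of F) and Ss n (subsets of S), up to step N *)
Record geim_run (N : option nat) (eta : R) (F : set X) (S : set (X -> R^o))
    (Fs : nat -> set X) (Ss : nat -> set (X -> R^o))
    (phi : nat -> X) (sigma : nat -> X -> R^o) : Prop := {
  run_F_sub : forall n, index_le n N -> Fs n `<=` F ;
  run_F_nested : forall m n, (m <= n)%N -> index_le n N -> Fs m `<=` Fs n ;
  run_S_sub : forall n, index_le n N -> Ss n `<=` S ;
  run_S_nested : forall m n, (m <= n)%N -> index_le n N -> Ss m `<=` Ss n ;
  run_finite : eta < 1 ->
    forall n, index_le n N -> finite_set (Fs n) /\ finite_set (Ss n) ;
  run_full : eta = 1 -> forall n, index_le n N -> Fs n = F ;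
  run_separating : forall n, index_le n N -> separating (Ss n) (Fs n) ;
  run_closed : forall n, index_le n N -> closed_values (Ss n) (Fs n) ;
  run_phi0 : argmax (Fs 0%N) (fun f => `|f|) (phi 0%N) ;
  run_sigma0 : argmax (Ss 0%N) (fun s => `|s (phi 0%N)|) (sigma 0%N) ;
  run_phi : forall n, (1 <= n)%N -> index_le n N ->
    argmax (Fs n) (fun f => `|f - geim_interp phi sigma n f|) (phi n) ;
  run_sigma : forall n, (1 <= n)%N -> index_le n N ->
    argmax (Ss n)
      (fun s => `|s (phi n - geim_interp phi sigma n (phi n))|) (sigma n) ;
  run_weak0 :
    eta * sup [set `|f| | f in F] <= sup [set `|f| | f in Fs 0%N] ;
  run_weak : forall n, (1 <= n)%N -> index_le n N ->
    eta * sup [set `|f - geim_interp phi sigma n f| | f in F]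
      <= sup [set `|f - geim_interp phi sigma n f| | f in Fs n] }.

Definition lebesgue_constant (phi : nat -> X) (sigma : nat -> X -> R^o)
    (n : nat) : R :=
  opnorm (geim_interp phi sigma n).

Definition geim_gamma (eta : R) (phi : nat -> X) (sigma : nat -> X -> R^o)
    (n : nat) : R :=
  eta / (1 + lebesgue_constant phi sigma n).

End GEIM.

Section Beta.
Context {R : realType}.
Implicit Types (eta alpha : R) (gamma : nat -> R).

(* (k + 3) %/ 4 is the ceiling of k / 4 *)
Definition ell1 (l k : nat) : nat := (2 * l + (2 * k) %/ 3)%N.
Definition ell2 (l k : nat) : nat := (2 * (l + (k + 3) %/ 4))%N.

(* beta_n in terms of b = beta_(ell1), for n = 4 l + k >= 2 *)
Definition beta_alg_step alpha gamma (l k : nat) (b : R) : R :=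
  (\prod_(1 <= i < (ell2 l k).+1)
      gamma (ell1 l k - (k + 3) %/ 4 + i)%N `^ (ell2 l k)%:R^-1)^-1
  * Num.sqrt (2 * (ell2 l k)%:R * b) * (2 * Num.sqrt 2) `^ alpha.

Fixpoint beta_alg_rec eta alpha gamma (fuel n : nat) : R :=
  if fuel is m.+1 then
    if (n <= 1)%N then 2 * (1 + eta^-1)
    else beta_alg_step alpha gamma (n %/ 4) (n %% 4)
           (beta_alg_rec eta alpha gamma m (ell1 (n %/ 4) (n %% 4)))
  else 2 * (1 + eta^-1).

(* The recursion is on ell1 < n, so that n units of fuel suffice: the value is
   characterized by beta_alg1 and beta_algE below. *)
Definition beta_alg eta alpha gamma (n : nat) : R :=
  beta_alg_rec eta alpha gamma n n.

Lemma beta_alg1 eta alpha gamma : beta_alg eta alpha gamma 1 = 2 * (1 + eta^-1).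
Proof. by []. Qed.

Lemma beta_algE eta alpha gamma (l k : nat) :
  (k < 4)%N -> (2 <= 4 * l + k)%N ->
  beta_alg eta alpha gamma (4 * l + k) =
  beta_alg_step alpha gamma l k (beta_alg eta alpha gamma (ell1 l k)).
Proof.
have fuelE m1 m2 n : (n <= m1)%N -> (n <= m2)%N ->
    beta_alg_rec eta alpha gamma m1 n = beta_alg_rec eta alpha gamma m2 n.
  elim: m1 m2 n => [|m1 IH] [|m2] n //=; [by case: n| by case: n|].
  by move=> h1 h2; case: ltnP => // h; rewrite (IH m2) // /ell1; lia.
move=> k4 n2; rewrite /beta_alg.
have ell1_le : (ell1 l k <= (4 * l + k).-1)%N by rewrite /ell1; lia.
have -> : (4 * l + k = (4 * l + k).-1.+1)%N by lia.
rewrite [LHS]/= prednK; last by lia.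
rewrite leqNgt n2 /= mulnC divnMDl // modnMDl modn_small // divn_small // addn0.
by rewrite (fuelE _ (ell1 l k)) // mulnC.
Qed.

(* the coefficient beta_n for exponentially decaying widths *)
Definition beta_exp eta gamma (n : nat) : R :=
  if (n <= 1)%N then 2 * (1 + eta^-1)
  else Num.sqrt 2
       * (\prod_(1 <= i < (2 * (n %/ 2)).+1)
            gamma i `^ (2 * (n %/ 2))%:R^-1)^-1
       * Num.sqrt n%:R.

End Beta.

(* Main.v *)
Require Import Defs.
From HB Require Import structures.
From mathcomp Require Import all_boot all_order all_algebra.
From mathcomp Require Import all_classical all_reals all_analysis.
From mathcomp Require Import ring lra zify.

Set Implicit Arguments.
Unset Strict Implicit.
Unset Printing Implicit Defensive.

Import Order.TTheory GRing.Theory Num.Theory.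
Import numFieldNormedType.Exports.

Local Open Scope classical_set_scope.
Local Open Scope ring_scope.

(* Let s_n be the supremum over F of the distance to X_n.  As J_n is a bounded
   projection onto X_n, the GEIM error is at most (1 + Lambda_n) s_n, and the
   weak greedy choice gives gamma_n s_n <= dist(phi_n, X_n).  The remaining
   argument is that of DeVore, Petrova and Wojtaszczyk.  With K = 2m and
   functionals lambda_j of norm at most 1 that vanish on X_j and attain
   dist(phi_j, X_j) at phi_j, the K x K matrix of the values
   lambda_(n0+j)(phi_(n0+i)) is triangular, and it lies within d_m of a matrix
   of rank at most m, obtained by replacing the phi's by approximations in an
   m-dimensional space.  Hadamard's inequality, after rescaling along that rank
   m row space, bounds the product of the diagonal entries by
   (2 K s_(n0+1) d_m)^m, whence
     s_(n0+K)^2 prod_(i <= K) gamma_(n0+i)^(2/K) <= 2 K s_(n0+1) d_m.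
   Part (i) is an induction on n, with n0 + K = n and n0 + 1 >= ell_1, and
   part (ii) is the case n0 = 0, where s_1 <= 1. *)

(** * Hadamard's inequality and perturbations of low-rank matrices *)

(** The squared Frobenius norm. In this trace form, orthogonality of rows becomes matrix algebra. *)
Definition sqnorm_mx (R : realFieldType) m n (A : 'M[R]_(m, n)) : R :=
  \tr (A *m A^T).

Section FrobeniusNorm.
Variable R : realFieldType.

Lemma sqnorm_mxE m n (A : 'M[R]_(m, n)) :
  sqnorm_mx A = \sum_i \sum_j A i j ^+ 2.
Proof.
rewrite /sqnorm_mx /mxtrace; apply: eq_bigr => i _; rewrite mxE.
by apply: eq_bigr => j _; rewrite mxE expr2.
Qed.

Lemma sqnorm_mx_ge0 m n (A : 'M[R]_(m, n)) : 0 <= sqnorm_mx A.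
Proof.
by rewrite sqnorm_mxE; do 2!apply: sumr_ge0 => ? _; exact: sqr_ge0.
Qed.

Lemma sqnorm_mx_eq0 m n (A : 'M[R]_(m, n)) : sqnorm_mx A = 0 -> A = 0.
Proof.
rewrite sqnorm_mxE => /eqP; rewrite psumr_eq0; last first.
  by move=> i _; apply: sumr_ge0 => j _; exact: sqr_ge0.
move=> /allP A0; apply/matrixP => i j; rewrite mxE; apply/eqP.
have := A0 i (mem_index_enum _).
rewrite /= psumr_eq0; last by move=> ? _; exact: sqr_ge0.
by move=> /allP/(_ j (mem_index_enum _)); rewrite /= sqrf_eq0.
Qed.

Lemma sqnorm_mx_le m n (A : 'M[R]_(m, n)) b : 0 <= b ->
  (forall i j, `|A i j| <= b) -> sqnorm_mx A <= m%:R * (n%:R * b ^+ 2).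
Proof.
move=> b0 Ab; rewrite sqnorm_mxE.
have sumb k c : \sum_(i < k) c = k%:R * c :> R.
  by rewrite sumr_const card_ord mulr_natl.
rewrite -sumb; apply: ler_sum => i _; rewrite -sumb; apply: ler_sum => j _.
by rewrite -(real_normK (num_real (A i j))) lerXn2r ?nnegrE.
Qed.

Lemma sqnorm_mx_row m n (A : 'M[R]_(m, n)) :
  sqnorm_mx A = \sum_i sqnorm_mx (row i A).
Proof.
rewrite sqnorm_mxE; apply: eq_bigr => i _; rewrite sqnorm_mxE big_ord1.
by apply: eq_bigr => j _; rewrite mxE.
Qed.

(** If u V V^T = 0, then the squared norm of u V is 0, so u V = 0 and u = 0. *)
Lemma gram_unitmx m n (V : 'M[R]_(m, n)) :
  row_free V -> V *m V^T \in unitmx.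
Proof.
move=> Vfree; rewrite -row_free_unit -kermx_eq0 -submx0.
apply/rV_subP => u /sub_kermxP uVV; rewrite submx0; apply/eqP.
apply/(row_free_inj Vfree); rewrite mul0mx; apply: sqnorm_mx_eq0.
by rewrite /sqnorm_mx trmx_mul mulmxA -(mulmxA u) uVV mul0mx mxtrace0.
Qed.

(** P is V^T (V V^T)^-1 V for a row basis V of U; it acts on row vectors from the right. *)
Lemma orthogonal_projection m n (U : 'M[R]_(m, n)) :
  exists P : 'M[R]_n,
    [/\ P^T = P, P *m P = P, U *m P = U & (P :=: U)%MS].
Proof.
move: (row_base U) (row_base_free U) (eq_row_base U) => V /gram_unitmx Vunit VU.
pose S := invmx (V *m V^T).
exists (V^T *m S *m V).
have ST : S^T = S by rewrite /S trmx_inv trmx_mul trmxK.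
have VP : V *m (V^T *m S *m V) = V by rewrite !mulmxA mulmxV // mul1mx.
have UP : U *m (V^T *m S *m V) = U.
  have /submxP[D UE] : (U <= V)%MS by rewrite VU.
  by have := congr1 (mulmx D) VP; rewrite mulmxA -UE.
split=> //.
- by rewrite 2!trmx_mul ST trmxK mulmxA.
- by rewrite -(mulmxA (V^T *m S)) VP.
apply/eqmxP/andP; split; last by rewrite -{1}UP submxMl.
by apply: (submx_trans (submxMl _ _)); rewrite VU.
Qed.

Lemma sqnorm_mxD m n (A B : 'M[R]_(m, n)) : A *m B^T = 0 ->
  sqnorm_mx (A + B) = sqnorm_mx A + sqnorm_mx B.
Proof.
move=> AB; rewrite /sqnorm_mx linearD /= mulmxDl !mulmxDr AB addr0.
by rewrite -(trmxK (B *m A^T)) trmx_mul trmxK AB trmx0 add0r linearD.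
Qed.

Lemma sqnorm_mxZ m n (a : R) (A : 'M[R]_(m, n)) :
  sqnorm_mx (a *: A) = a ^+ 2 * sqnorm_mx A.
Proof.
by rewrite /sqnorm_mx linearZ /= -scalemxAl -scalemxAr scalerA linearZ expr2.
Qed.

(** Pythagoras: the rows of A P are orthogonal to those of A (1 - P). *)
Lemma sqnorm_mx_proj m n (P : 'M[R]_n) (A : 'M[R]_(m, n)) (a b : R) :
  P^T = P -> P *m P = P ->
  sqnorm_mx (A *m (a *: P + b *: (1%:M - P))) =
  a ^+ 2 * sqnorm_mx (A *m P) + b ^+ 2 * sqnorm_mx (A *m (1%:M - P)).
Proof.
move=> PT PP; rewrite (mulmxDr _ (a *: P)) -!scalemxAr sqnorm_mxD ?sqnorm_mxZ //.
rewrite linearZ /= -scalemxAl -scalemxAr trmx_mul linearB /= trmx1 PT mulmxA.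
by rewrite -(mulmxA A) mulmxBr mulmx1 PP subrr mulmx0 mul0mx !scaler0.
Qed.

Lemma sqnorm_mx_projD m n (P : 'M[R]_n) (A : 'M[R]_(m, n)) :
  P^T = P -> P *m P = P ->
  sqnorm_mx A = sqnorm_mx (A *m P) + sqnorm_mx (A *m (1%:M - P)).
Proof.
move=> PT PP; have := sqnorm_mx_proj A 1 1 PT PP.
by rewrite !scale1r addrC subrK mulmx1 expr1n !mul1r.
Qed.

(* Gram-Schmidt: N = T M, with T unitriangular and the rows of N orthogonal. *)
Lemma hadamard n (M : 'M[R]_n) :
  \det M ^+ 2 <= \prod_i sqnorm_mx (row i M).
Proof.
(* The rows of M before i, padded with zero rows so that all [U i] have the same shape. *)
pose U (i : 'I_n) := \matrix_(j < n) (if (j < i)%N then row j M else 0).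
have /fin_all_exists[P Pproj] : forall i, exists P : 'M[R]_n,
  [/\ P^T = P, P *m P = P, U i *m P = U i & (P :=: U i)%MS].
  by move=> i; exact: orthogonal_projection.
have /fin_all_exists[c cE] : forall i, exists c : 'rV[R]_n,
    row i M *m P i = c *m U i.
  move=> i; have [_ _ _ PU] := Pproj i; apply/submxP.
  by apply: (submx_trans (submxMl _ _)); rewrite PU.
pose T := \matrix_(i, j)
  ((i == j)%:R - (if (j < i)%N then c i 0 j else 0)) : 'M[R]_n.
pose N := T *m M.
have detT : \det T = 1.
  rewrite det_trig; first by apply: big1 => i _; rewrite mxE eqxx ltnn subr0.
  apply/is_trig_mxP => i j ij; rewrite mxE (ltnNge j) (ltnW ij) subr0.
  by rewrite -val_eqE /= ltn_eqF.
have rowN i : row i N = row i M *m (1%:M - P i).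
  rewrite mulmxBr mulmx1 cE; apply/rowP => k; rewrite !mxE.
  under eq_bigr do rewrite mxE mulrBl.
  rewrite sumrB (bigD1 i) //= eqxx mul1r big1 ?addr0; last first.
    by move=> j /negPf ji; rewrite eq_sym ji mul0r.
  congr (_ - _); apply: eq_bigr => j _; rewrite mxE.
  by case: ifP => _; rewrite !mxE ?mul0r ?mulr0.
have orthNM (i k : 'I_n) : (k < i)%N -> row i N *m (row k M)^T = 0.
  move=> ki; have [PT PP UP _] := Pproj i.
  have UQ : U i *m (1%:M - P i) = 0 by rewrite mulmxBr mulmx1 UP subrr.
  have -> : row k M = row k (U i) by rewrite rowK ki.
  rewrite rowN -mulmxA -{1}PT -trmx1 -linearB /= -trmx_mul -(row_mul k).
  by rewrite UQ row0 trmx0 mulmx0.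
have orthN (i j : 'I_n) : (j < i)%N -> (N *m N^T) i j = 0.
  move=> ji; have -> : (N *m N^T) i j = (row i N *m (row j N)^T) 0 0.
    by rewrite !mxE; apply: eq_bigr => k _; rewrite !mxE.
  have -> : row j N = \sum_k T j k *: row k M.
    by rewrite row_mul mulmx_sum_row; apply: eq_bigr => k _; rewrite mxE.
  rewrite linear_sum /= mulmx_sumr summxE big1 // => k _.
  rewrite linearZ /= -scalemxAr mxE.
  have [kj|jk] := leqP k j; first by rewrite orthNM ?(leq_ltn_trans kj) // [X in _ * X]mxE mulr0.
  by rewrite [T j k]mxE ltnNge (ltnW jk) -val_eqE /= ltn_eqF // subr0 mul0r.
have -> : \det M = \det N by rewrite det_mulmx detT mul1r.
(* The square of det N is the determinant of the Gram matrix N N^T, diagonal by orthogonality. Its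
   i-th entry is the squared norm of row i of M with a projection removed, hence at most that of row
   i of M. *)
rewrite expr2 -{2}(det_tr N) -det_mulmx det_trig; last first.
  apply/is_trig_mxP => i j ij.
  rewrite -[N *m N^T]trmxK trmx_mul trmxK mxE; exact: orthN.
apply: ler_prod => i _.
have -> : (N *m N^T) i i = sqnorm_mx (row i N).
  rewrite /sqnorm_mx /mxtrace big_ord1 !mxE; apply: eq_bigr => k _.
  by rewrite !mxE.
have [PT PP _ _] := Pproj i.
by rewrite sqnorm_mx_ge0 /= rowN (sqnorm_mx_projD (row i M) PT PP) lerDr sqnorm_mx_ge0.
Qed.

(** Hadamard's inequality followed by the inequality of arithmetic and geometric means for the
    squared row norms. *)
Lemma det_le_sqnorm_mx n (M : 'M[R]_n) :
  \det M ^+ 2 <= (sqnorm_mx M / n%:R) ^+ n.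
Proof.
apply: le_trans (hadamard M) _; rewrite sqnorm_mx_row.
have [] := @leif_AGM R 'I_n predT (fun i => sqnorm_mx (row i M)).
  by move=> i _; exact: sqnorm_mx_ge0.
by rewrite card_ord.
Qed.

(* P = C B with B C = 1; exchange the factors in det (1 + c C B) by multiplying
   block triangular matrices in both orders. *)
Lemma det_idempotent n (P : 'M[R]_n) (c : R) : P *m P = P ->
  \det (1%:M + c *: P) = (1 + c) ^+ \rank P.
Proof.
pose C := col_base P; pose B := row_base P.
move=> PP; have CB : C *m B = P := mulmx_base P.
have BC : B *m C = 1%:M.
  apply: (row_full_inj (col_base_full P)); apply: (row_free_inj (row_base_free P)).
  by rewrite mulmx1 -/C -/B mulmxA -mulmxA CB PP.
pose X := block_mx 1%:M (- (c *: C)) B 1%:M.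
have := det_mulmx X (block_mx 1%:M (c *: C) 0 1%:M).
have := det_mulmx (block_mx 1%:M (c *: C) 0 1%:M) X.
rewrite /X !mulmx_block !(mul1mx, mulmx1, mul0mx, mulmx0, addr0, add0r).
rewrite addNr addrN -scalemxAl -scalemxAr BC CB !(det_ublock, det_lblock, det1, mul1r, mulr1).
move=> -> <-.
by rewrite -[X in _ + X]scale1r -scalerDl detZ det1 mulr1 addrC.
Qed.

End FrobeniusNorm.

(* Hadamard's inequality for [G *m D], where [D] is [1 / sqrt A] times the
   orthogonal projection onto the row space of [H] plus [1 / sqrt B] times the
   complementary projection. *)
Lemma det_near_low_rank (R : rcfType) m (G H : 'M[R]_(2 * m)) (A B : R) :
  (0 < m)%N -> (\rank H <= m)%N -> 0 <= A -> 0 < B ->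
  sqnorm_mx G <= (2 * m)%:R * A -> sqnorm_mx (G - H) <= (2 * m)%:R * B ->
  \det G ^+ 2 <= (4 * A * B) ^+ m.
Proof.
move=> m_gt0 rankH A_ge0 B_gt0 GA GB.
have K_gt0 : 0 < (2 * m)%:R :> R by rewrite ltr0n; lia.
have normG_ge0 := sqnorm_mx_ge0 G.
(* If A < B, the previous determinant bound already gives (det G)^2 <= A^(2m) <= (4 A B)^m. *)
have [AB|BA] := ltP A B.
  apply: le_trans (det_le_sqnorm_mx G) _; rewrite exprM.
  have GA' : sqnorm_mx G / (2 * m)%:R <= A by rewrite ler_pdivrMr // mulrC.
  have GA0 : 0 <= sqnorm_mx G / (2 * m)%:R by rewrite divr_ge0 // ltW.
  rewrite lerXn2r ?nnegrE ?exprn_ge0 //; first by nra.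
  by nra.
have A_gt0 : 0 < A := lt_le_trans B_gt0 BA.
have [P [PT PP HP PH]] := orthogonal_projection H.
pose a := (Num.sqrt A)^-1; pose b := (Num.sqrt B)^-1.
have a2 : a ^+ 2 = A^-1 by rewrite exprVn sqr_sqrtr.
have b2 : b ^+ 2 = B^-1 by rewrite exprVn sqr_sqrtr // ltW.
have a_gt0 : 0 < a by rewrite invr_gt0 sqrtr_gt0.
have b_gt0 : 0 < b by rewrite invr_gt0 sqrtr_gt0.
pose D := a *: P + b *: (1%:M - P).
(* With r the rank of H, (det D)^2 = A^-r B^-(2m - r); as r <= m and B <= A, turning m - r factors
   B^-1 into A^-1 can only decrease it. *)
have detD : \det D ^+ 2 >= (A * B) ^- m.
  have -> : D = b *: (1%:M + (a / b - 1) *: P).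
    by apply/matrixP => i j; rewrite !mxE; field; rewrite gt_eqF.
  rewrite detZ det_idempotent // PH addrC subrK.
  have -> : (b ^+ (2 * m) * (a / b) ^+ \rank H) ^+ 2 =
            (A^-1) ^+ \rank H * (B^-1) ^+ (m - \rank H) * (B^-1) ^+ m.
    rewrite -a2 -b2 -!exprM expr_div_n.
    have -> : b ^+ (2 * m) = b ^+ \rank H * b ^+ \rank H * b ^+ (2 * (m - \rank H)).
      by rewrite -!exprD addnn -mul2n -mulnDr subnKC.
    rewrite !(mulnC 2 (_ - _)%N) (mulnC 2 (\rank _)) !exprM.
    have := expf_neq0 (\rank H) (lt0r_neq0 b_gt0).
    set x := b ^+ \rank H; set y := a ^+ \rank H; set z := b ^+ (m - \rank H).
    by move=> x0; field.
  rewrite exprMn invfM -!exprVn ler_wpM2r ?exprn_ge0 ?invr_ge0 // ?(ltW B_gt0) //.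
  rewrite -{1}(subnKC rankH) exprD ler_wpM2l ?exprn_ge0 ?invr_ge0 //.
  by rewrite lerXn2r ?nnegrE ?invr_ge0 // ?(ltW B_gt0) // lef_pV2.
(* Both parts of G D contribute at most 2m: G P is bounded through G, and G (1 - P) = (G - H) (1 -
   P) through G - H. *)
have normGD : sqnorm_mx (G *m D) <= (2 * m)%:R * 2.
  rewrite sqnorm_mx_proj // a2 b2.
  have GP : sqnorm_mx (G *m P) <= (2 * m)%:R * A.
    apply: le_trans GA; rewrite (sqnorm_mx_projD G PT PP) lerDl.
    exact: sqnorm_mx_ge0.
  have GQ : sqnorm_mx (G *m (1%:M - P)) <= (2 * m)%:R * B.
    have <- : (G - H) *m (1%:M - P) = G *m (1%:M - P).
      by rewrite mulmxBl (mulmxBr H) mulmx1 HP subrr subr0.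
    apply: le_trans GB; rewrite (sqnorm_mx_projD (G - H) PT PP) lerDr.
    exact: sqnorm_mx_ge0.
  by rewrite mulr2n mulrDr mulr1 lerD // mulrC ler_pdivrMr.
have := det_le_sqnorm_mx (G *m D); rewrite det_mulmx exprMn => detGD.
have : \det G ^+ 2 * (A * B) ^- m <= 4 ^+ m.
  apply: le_trans (ler_wpM2l (sqr_ge0 _) detD) (le_trans detGD _).
  rewrite exprM lerXn2r ?nnegrE ?exprn_ge0 ?ler0n ?divr_ge0 ?sqnorm_mx_ge0 ?ler0n //.
  have -> : 4 = 2 ^+ 2 :> R by ring.
  rewrite lerXn2r ?nnegrE ?divr_ge0 ?sqnorm_mx_ge0 ?ler0n //.
  by rewrite ler_pdivrMr // mulrC.
by rewrite ler_pdivrMr ?exprn_gt0 ?mulr_gt0 // -exprMn mulrA.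
Qed.

(** * A finite Hahn-Banach theorem and distances to subspaces *)

(* Hahn-Banach for the finite family [v], in coordinates: [c i] is the value at
   [v i] of a functional dominated by [p] that attains [p] at [v i0]. *)
Lemma finite_hahn_banach (R : realType) (V : lmodType R) (p : V -> R)
    (I : finType) (v : I -> V) (i0 : I) :
  (forall x y, p (x + y) <= p x + p y) ->
  (forall a x, p (a *: x) = `|a| * p x) ->
  exists c : I -> R, c i0 = p (v i0) /\
    forall a : I -> R, `|\sum_i a i * c i| <= p (\sum_i a i *: v i).
Proof.
move=> pD pZ.
suff [c [c0 cP]] : exists c : I -> R, c i0 = p (v i0) /\
    forall a : I -> R, \sum_i a i * c i <= p (\sum_i a i *: v i).
  exists c; split=> // a; rewrite ler_norml cP andbT lerNl -sumrN.
  under eq_bigr do rewrite -mulNr.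
  apply: le_trans (cP _) _; under eq_bigr do rewrite scaleNr.
  by rewrite sumrN -scaleN1r pZ normrN1 mul1r.
(* The vectors are added one at a time; domination is claimed for coefficients supported on
   [i0 :: s]. *)
suff main : forall s : seq I, exists c : I -> R, c i0 = p (v i0) /\
    forall a : I -> R, (forall i, i \notin i0 :: s -> a i = 0) ->
      \sum_i a i * c i <= p (\sum_i a i *: v i).
  have [c [c0 cP]] := main (enum I); exists c; split=> // a; apply: cP => i.
  by rewrite inE mem_enum orbT.
elim=> [|i s [c [c0 cP]]].
  exists (fun=> p (v i0)); split=> // a a0.
  rewrite (bigD1 i0) //= big1 ?addr0; last first.
    by move=> i ii0; rewrite a0 ?inE // mul0r.
  rewrite (bigD1 i0) //= big1 ?addr0; last first.
    by move=> i ii0; rewrite a0 ?inE // scale0r.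
  have p0 : 0 <= p (v i0).
    have := pD (v i0) ((-1) *: v i0); rewrite pZ normrN normr1 mul1r scaleN1r.
    by rewrite subrr -(scale0r 0) pZ normr0 mul0r -mulr2n pmulrn_lge0.
  by rewrite pZ ler_wpM2r // ler_norm.
have [iS|iS] := boolP (i \in i0 :: s).
  exists c; split=> // a a0; apply: cP => j js; apply: a0.
  by apply: contra js; rewrite !inE => /or3P[->|/eqP->|->]; rewrite ?orbT // -in_cons.
pose supp := [set a : I -> R | forall j, j \notin i0 :: s -> a j = 0].
pose f (a : I -> R) := \sum_j a j * c j.
pose w (a : I -> R) := \sum_j a j *: v j.
(* The value [t] at the new vector [v i] has to lie above every [f a - p (w a - v i)] and below
   every [p (w b + v i) - f b]; [LU] shows, from domination on the old span, that this is
   possible. *)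
pose L := [set f a - p (w a - v i) | a in supp].
pose t := sup L.
have wD a b : w (fun j => a j + b j) = w a + w b.
  by rewrite -big_split; apply: eq_bigr => j _; rewrite scalerDl.
have fD a b : f (fun j => a j + b j) = f a + f b.
  by rewrite -big_split; apply: eq_bigr => j _; rewrite mulrDl.
have wZ k a : w (fun j => k * a j) = k *: w a.
  by rewrite scaler_sumr; apply: eq_bigr => j _; rewrite scalerA.
have fZ k a : f (fun j => k * a j) = k * f a.
  by rewrite mulr_sumr; apply: eq_bigr => j _; rewrite mulrA.
have LU a b : supp a -> supp b -> f a - p (w a - v i) <= p (w b + v i) - f b.
  move=> sa sb; rewrite lerBrDr addrAC lerBlDr -fD.
  apply: le_trans (cP _ _) _ => [j js|]; first by rewrite sa ?sb ?addr0.
  apply: le_trans (pD _ _); rewrite -/(w _) wD.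
  by rewrite addrACA addrN addr0 //= [w b + w a]addrC.
have supp0 : supp (fun=> 0) by [].
have Lt a : supp a -> f a - p (w a - v i) <= t.
  move=> sa; apply: ub_le_sup; last by exists a.
  by exists (p (w (fun=> 0) + v i) - f (fun=> 0)) => _ [b sb <-]; exact: LU.
have tU b : supp b -> t <= p (w b + v i) - f b.
  move=> sb; apply: ge_sup; first by exists (f (fun=> 0) - p (w (fun=> 0) - v i)), (fun=> 0).
  by move=> _ [a sa <-]; exact: LU.
exists (fun j => if j == i then t else c j); split.
  by case: eqP iS => // <-; rewrite inE eqxx.
move=> a sa; pose b j := if j == i then 0 else a j.
have sb k : supp (fun j => k * b j).
  move=> j js; rewrite /b; case: eqP => [|/eqP ji]; rewrite ?mulr0 //.
  by rewrite sa ?mulr0 // !inE !negb_or ji; move: js; rewrite inE negb_or.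
have -> : \sum_j a j * (if j == i then t else c j) = f b + a i * t.
  rewrite /f (bigD1 i) //= eqxx [in RHS](bigD1 i) //= /b eqxx mul0r add0r addrC.
  by congr (_ + _); apply: eq_bigr => j /negPf ->.
have -> : \sum_j a j *: v j = w b + a i *: v i.
  rewrite /w (bigD1 i) //= [in RHS](bigD1 i) //= /b eqxx scale0r add0r addrC.
  by congr (_ + _); apply: eq_bigr => j /negPf ->.
(* Dividing by the absolute value of [a i] reduces to the coefficients -1 and 1, where [Lt] and [tU]
   apply. *)
have [ai|ai|ai] := ltgtP (a i) 0.
- have /Lt := sb (- (a i)^-1); rewrite fZ wZ => H.
  have nai : 0 < - a i by rewrite oppr_gt0.
  have -> : w b + a i *: v i = - a i *: (- (a i)^-1 *: w b - v i).
    by rewrite scalerBr scalerA mulrNN divff ?lt_eqF // scale1r scaleNr opprK.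
  rewrite pZ gtr0_norm //.
  have := ler_wpM2l (ltW nai) H.
  by rewrite mulrBr mulrA mulrNN divff ?lt_eqF // mul1r mulNr lerBlDr mulNr; lra.
- have /tU := sb (a i)^-1; rewrite fZ wZ => H.
  have -> : w b + a i *: v i = a i *: ((a i)^-1 *: w b + v i).
    by rewrite scalerDr scalerA divff ?gt_eqF // scale1r.
  rewrite pZ gtr0_norm //.
  have := ler_wpM2l (ltW ai) H.
  by rewrite mulrBr mulrA divff ?gt_eqF // mul1r; lra.
rewrite ai mul0r scale0r !addr0; apply: cP => j js; move: (sb 1 j js).
by rewrite mul1r.
Qed.

(** [c] and [e] list the values at [x] and at [y] of one functional, obtained by treating both
    families together. The last bound makes [e] inherit the linear relations of [y], which will
    limit a rank. *)
Lemma hahn_banach_approx (R : realType) (V : lmodType R) (p : V -> R)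
    (I : finType) (x y : I -> V) (j : I) :
  (forall x y, p (x + y) <= p x + p y) ->
  (forall a x, p (a *: x) = `|a| * p x) ->
  exists c e : I -> R, [/\ c j = p (x j), forall i, `|c i| <= p (x i),
    forall i, `|c i - e i| <= p (x i - y i) &
    forall a : I -> R, `|\sum_i a i * e i| <= p (\sum_i a i *: y i)].
Proof.
move=> pD pZ.
pose v k := match k with inl i => x i | inr i => y i end.
have [c [cj cP]] := finite_hahn_banach v (inl j) pD pZ.
pose join (a b : I -> R) k := match k with inl i => a i | inr i => b i end.
have cP2 a b := cP (join a b).
have {cP2} cP2 a b : `|\sum_i a i * c (inl i) + \sum_i b i * c (inr i)|
    <= p (\sum_i a i *: x i + \sum_i b i *: y i).
  by have := cP2 a b; rewrite !big_sumType.
have delta i (W : lmodType R) (w : I -> W) (k : R) :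
    \sum_l (if l == i then k else 0) *: w l = k *: w i.
  by rewrite (bigD1 i) //= eqxx big1 ?addr0 // => l /negPf ->; rewrite scale0r.
have cP1 i (k l : R) : `|k * c (inl i) + l * c (inr i)| <= p (k *: x i + l *: y i).
  have := cP2 (fun m => if m == i then k else 0) (fun m => if m == i then l else 0).
  by rewrite !delta.
exists (c \o inl), (c \o inr); split=> [//|i|i|a] /=.
- by have := cP1 i 1 0; rewrite !(mul0r, scale0r, mul1r, scale1r, addr0).
- by have := cP1 i 1 (-1); rewrite !(mulN1r, scaleN1r, mul1r, scale1r).
have c0 : \sum_i 0 * c (inl i) = 0 by rewrite big1 // => i _; rewrite mul0r.
have x0 : \sum_i 0 *: x i = 0 by rewrite big1 // => i _; rewrite scale0r.
by have := cP2 (fun=> 0) a; rewrite c0 x0 !add0r.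
Qed.

Section Submodule.
Context {R : realType} {V : lmodType R}.
Implicit Types A B Y : set V.

Lemma submod_set0 Y : submod_closed (mem Y) -> Y 0.
Proof. by move=> [+ _]; rewrite inE. Qed.

Lemma submod_setD Y a x y :
  submod_closed (mem Y) -> Y x -> Y y -> Y (a *: x + y).
Proof. by move=> [_ /(_ a x y)]; rewrite !inE => YD Yx Yy; exact: YD. Qed.

Lemma submod_setZ Y a x : submod_closed (mem Y) -> Y x -> Y (a *: x).
Proof.
move=> Ysub Yx; rewrite -[_ *: _]addr0; apply: submod_setD => //.
exact: submod_set0.
Qed.

Lemma submod_setB Y x y : submod_closed (mem Y) -> Y x -> Y y -> Y (x - y).
Proof. by move=> Ysub Yx Yy; rewrite addrC -scaleN1r; exact: submod_setD. Qed.

Lemma lspan_submod A : submod_closed (mem (lspan A)).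
Proof.
split; first by rewrite inE; exists 0, (fun=> 0), (fun=> 0); split=> [[]//|]; rewrite big_ord0.
move=> k x y; rewrite !inE => -[m [a [v [Av ->]]]] [n [b [w [Aw ->]]]].
pose ab i := match fintype.split i with inl j => k * a j | inr j => b j end.
pose vw i := match fintype.split i with inl j => v j | inr j => w j end.
exists (m + n)%N, ab, vw; split=> [i|]; first by rewrite /vw; case: fintype.split.
rewrite big_split_ord scaler_sumr /=; congr (_ + _); apply: eq_bigr => i _.
  by rewrite /ab /vw (unsplitK (inl i)) scalerA.
by rewrite /ab /vw (unsplitK (inr i)).
Qed.

Lemma sub_lspan A : A `<=` lspan A.
Proof.
move=> x Ax; exists 1, (fun=> 1), (fun=> x); split=> //.
by rewrite big_ord1 scale1r.
Qed.

Lemma lspan_min A Y : submod_closed (mem Y) -> A `<=` Y -> lspan A `<=` Y.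
Proof.
move=> Ysub AY _ [n [a [v [Av ->]]]].
elim/big_rec: _ => [|i x _ Yx]; first exact: submod_set0.
by apply: submod_setD => //; exact: AY.
Qed.

Lemma lspan_subset A B : A `<=` B -> lspan A `<=` lspan B.
Proof.
by move=> AB; apply: lspan_min (lspan_submod B) _ => x /AB; exact: sub_lspan.
Qed.

Lemma dim_ge_leq Y m n : (m <= n)%N -> dim_ge Y n -> dim_ge Y m.
Proof.
move=> /subnKC <- [v [Yv vfree]]; exists (v \o lshift (n - m)).
split=> [i|a a0 i]; first exact: Yv.
pose b (k : 'I_(m + (n - m))) :=
  match fintype.split k with inl j => a j | inr _ => 0 end.
have bl j : b (lshift (n - m) j) = a j by rewrite /b (unsplitK (inl j)).
rewrite -bl; apply: vfree; rewrite big_split_ord /= [X in _ + X]big1 ?addr0.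
  by rewrite -[RHS]a0; apply: eq_bigr => j _; rewrite bl.
by move=> j _; rewrite /b (unsplitK (inr j)) scale0r.
Qed.

End Submodule.

Section Distance.
Context {R : realType} {V : normedModType R} (Y : set V).
Hypothesis Ysub : submod_closed (mem Y).

Lemma dist_to_le u v : Y v -> dist_to Y u <= `|u - v|.
Proof.
move=> Yv; apply: ge_inf; last by exists v.
by exists 0 => _ [w _ <-].
Qed.

Lemma dist_to_lub u c : (forall v, Y v -> c <= `|u - v|) -> c <= dist_to Y u.
Proof.
move=> cP; apply: lb_le_inf; first by exists `|u - 0|, 0 => //; exact: submod_set0.
by move=> _ [v Yv <-]; exact: cP.
Qed.

Lemma dist_to_ge0 u : 0 <= dist_to Y u.
Proof. exact: dist_to_lub. Qed.

Lemma dist_to_norm u : dist_to Y u <= `|u|.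
Proof. by have := dist_to_le u (submod_set0 Ysub); rewrite subr0. Qed.

Lemma dist_to_eq0 u : Y u -> dist_to Y u = 0.
Proof.
move=> Yu; apply/le_anti; rewrite dist_to_ge0 andbT.
by have := dist_to_le u Yu; rewrite subrr normr0.
Qed.

Lemma dist_to_lt u c : dist_to Y u < c -> exists2 v, Y v & `|u - v| < c.
Proof.
move=> uc; apply: contrapT => Yc; move: uc; apply/negP; rewrite -leNgt.
by apply: dist_to_lub => v Yv; rewrite leNgt; apply/negP => vc; apply: Yc; exists v.
Qed.

(** With [dist_toZ], this makes the distance a seminorm, the [p] of the Hahn-Banach argument. The
    infimum need not be attained, hence the approximations within e / 2. *)
Lemma dist_toD u1 u2 : dist_to Y (u1 + u2) <= dist_to Y u1 + dist_to Y u2.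
Proof.
apply/ler_addgt0Pl => e e0.
have e2 : 0 < e / 2 by rewrite divr_gt0.
have [v1 Y1 h1] := @dist_to_lt u1 (dist_to Y u1 + e / 2) ltac:(by rewrite ltrDl).
have [v2 Y2 h2] := @dist_to_lt u2 (dist_to Y u2 + e / 2) ltac:(by rewrite ltrDl).
have Y12 : Y (v1 + v2) by rewrite -(scale1r v1); exact: submod_setD.
apply: le_trans (dist_to_le _ Y12) _.
by rewrite opprD addrACA (le_trans (ler_normD _ _)) //; lra.
Qed.

Lemma dist_toZ a u : dist_to Y (a *: u) = `|a| * dist_to Y u.
Proof.
(* The inequality for all scalars also yields the reverse one, when applied to a^-1 and [a *: u]. *)
have le b x : dist_to Y (b *: x) <= `|b| * dist_to Y x.
  have [->|b0] := eqVneq b 0.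
    by rewrite scale0r normr0 mul0r dist_to_eq0 //; exact: submod_set0.
  have bn0 : 0 < `|b| by rewrite normr_gt0.
  rewrite mulrC -ler_pdivrMr //; apply: dist_to_lub => v Yv.
  rewrite ler_pdivrMr // mulrC -normrZ scalerBr dist_to_le //.
  exact: submod_setZ.
apply/le_anti; rewrite le /=; have [->|a0] := eqVneq a 0.
  by rewrite normr0 mul0r dist_to_ge0.
rewrite mulrC -ler_pdivlMr ?normr_gt0 // mulrC -normfV.
by apply: le_trans (le _ _); rewrite scalerA mulVf // scale1r.
Qed.

End Distance.

Lemma dist_to_subset (R : realType) (V : normedModType R) (Y Z : set V) (u : V) :
  submod_closed (mem Y) -> Y `<=` Z -> dist_to Z u <= dist_to Y u.
Proof. by move=> Ysub YZ; apply: dist_to_lub => // v /YZ; exact: dist_to_le. Qed.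

(** * The interpolation operators *)

(** A set with no supremum is assigned the default value 0. *)
Lemma sup_ge0 (R : realType) (A : set R) : (forall x, A x -> 0 <= x) -> 0 <= sup A.
Proof.
move=> A0; have [[[x Ax] Aub]|/sup_out ->//] := pselect (has_sup A).
exact: le_trans (A0 x Ax) (ub_le_sup Aub Ax).
Qed.

Section OperatorNorm.
Context {R : realType} {V W : normedModType R}.
Implicit Type f : V -> W.

Lemma norm_le_opnorm f x :
  f 0 = 0 -> has_ubound [set `|f x| / `|x| | x in [set x : V | x != 0]] ->
  `|f x| <= opnorm f * `|x|.
Proof.
move=> f0 fub; have [->|x0] := eqVneq x 0; first by rewrite f0 !normr0 mulr0.
by rewrite -ler_pdivrMr ?normr_gt0 //; apply: ub_le_sup => //; exists x.
Qed.

Lemma opnorm_ge0 f : 0 <= opnorm f.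
Proof. by apply: sup_ge0 => _ [x _ <-]; rewrite divr_ge0. Qed.

End OperatorNorm.

Section Interpolation.
Context {R : realType} {X : completeNormedModType R}.
Variables (phi : nat -> X) (sigma : nat -> X -> R^o).
Implicit Types (f g : X) (n : nat).

Let Xsub n : submod_closed (mem (geim_space phi n)).
Proof. exact: lspan_submod. Qed.

Lemma geim_space_le m n :
  (m <= n)%N -> geim_space phi m `<=` geim_space phi n.
Proof.
by move=> mn; apply: lspan_subset => _ [i /= im <-]; exists i => //=;
  exact: leq_trans mn.
Qed.

Lemma geim_space_phi i n : (i < n)%N -> geim_space phi n (phi i).
Proof. by move=> ilt; apply: sub_lspan; exists i. Qed.

Lemma geim_space0 f : geim_space phi 0 f -> f = 0.
Proof.
by move=> [[|k] [a [v [Av ->]]]]; [rewrite big_ord0|have [j] := Av ord0].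
Qed.

(** The vectors with this property form a subspace containing all generators. *)
Lemma geim_space_recr n f : geim_space phi n.+1 f ->
  exists a, geim_space phi n (f - a *: phi n).
Proof.
pose Y := [set f | exists a, geim_space phi n (f - a *: phi n)].
apply: (@lspan_min _ _ _ Y) f; last first.
  move=> _ [i /= + <-]; rewrite ltnS leq_eqVlt => /orP[/eqP->|ilt].
    by exists 1; rewrite scale1r subrr; exact: submod_set0.
  by exists 0; rewrite scale0r subr0; exact: geim_space_phi.
split; first by rewrite inE; exists 0; rewrite scale0r subr0; exact: submod_set0.
move=> k x y; rewrite !inE => -[a xa] [b yb]; exists (k * a + b).
rewrite scalerDl -scalerA opprD addrACA -scalerBr; exact: submod_setD.
Qed.

Lemma geim_spaceP n f : geim_space phi n f ->
  exists a : nat -> R, f = \sum_(i < n) a i *: phi i.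
Proof.
elim: n f => [|n IH] f; first by move=> /geim_space0 ->; exists (fun=> 0); rewrite big_ord0.
move=> /geim_space_recr[b /IH[a fE]]; exists (fun i => if i == n then b else a i).
rewrite big_ord_recr /= eqxx; under eq_bigr do rewrite ltn_eqF //.
by rewrite -fE subrK.
Qed.

(** The coefficients of n + 1 vectors form a matrix with n columns, so a nonzero row vector kills it
    from the left and gives a relation. *)
Lemma geim_space_dim n : dim_le (geim_space phi n) n.
Proof.
move=> [v [vX vfree]].
have /choice[a aE] : forall i, exists a : nat -> R, v i = \sum_(j < n) a j *: phi j.
  by move=> i; exact: geim_spaceP.
pose A := \matrix_(i < n.+1, j < n) a i j.
have /rowV0Pn[u /sub_kermxP uA /rV0Pn[i]] : kermx A != 0.
  by rewrite kermx_eq0 /row_free neq_ltn ltnS rank_leq_col.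
rewrite (vfree (u 0)) ?eqxx //.
under eq_bigr do rewrite aE scaler_sumr.
rewrite exchange_big big1 //= => j _.
under eq_bigr do rewrite scalerA.
rewrite -scaler_suml; have /rowP/(_ j) := uA.
rewrite !mxE => uA0; transitivity (0 *: phi j); last exact: scale0r.
by congr (_ *: _); rewrite -[RHS]uA0; apply: eq_bigr => k _; rewrite mxE.
Qed.

(* Newton form of J_n: the residual of phi_k at step k is annihilated by sigma_i
   for i < k, so adding a multiple of it keeps the earlier interpolation
   conditions. *)
Fixpoint newton_interp n f : X :=
  if n is k.+1 then
    let r := phi k - newton_interp k (phi k) in
    newton_interp k f + (sigma k (f - newton_interp k f) / sigma k r) *: r
  else 0.

Let r n := phi n - newton_interp n (phi n).

Lemma newton_interp_space n f : geim_space phi n (newton_interp n f).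
Proof.
elim: n f => [|n IH] f /=; first exact: submod_set0.
have IHS g := geim_space_le (leqnSn n) (IH g).
rewrite addrC; apply: submod_setD => //.
by apply: submod_setB => //; exact: geim_space_phi.
Qed.

(** The cutoff [n0] lets these facts be used within the induction that proves the pivots
    sigma_i(r_i) nonzero. *)
Variable n0 : nat.
Hypothesis sigma_linear : forall i, (i < n0)%N -> linear (sigma i).
Hypothesis sigma_r : forall i, (i < n0)%N -> sigma i (r i) != 0.

Let sigmaB i : (i < n0)%N -> {morph sigma i : x y / x - y}.
Proof. by move=> /sigma_linear lin; exact: (zmod_morphism_linear lin). Qed.

Let sigmaZ i : (i < n0)%N -> scalable (sigma i).
Proof. by move=> /sigma_linear lin; exact: (scalable_linear lin). Qed.

Let sigmaD i : (i < n0)%N -> {morph sigma i : x y / x + y}.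
Proof. by move=> /sigma_linear lin x y; rewrite -[x]scale1r lin !scale1r. Qed.

Lemma newton_interp_linear n : (n <= n0)%N -> linear (newton_interp n).
Proof.
elim: n => [|n IH] ltn0 k x y /=; first by rewrite scaler0 addr0.
rewrite IH ?(ltnW ltn0) //= (scalerDr k (newton_interp n x)) scalerA addrACA.
rewrite -scalerDl; congr (_ + _ *: _).
rewrite opprD addrACA -scalerBr (sigma_linear ltn0) mulrDl /=; congr (_ + _).
by rewrite mulrA.
Qed.

Lemma newton_interpP n i f : (n <= n0)%N -> (i < n)%N ->
  sigma i (newton_interp n f) = sigma i f.
Proof.
elim: n f => [//|n IH] f ltn0; rewrite ltnS leq_eqVlt => /orP[/eqP->|ilt] /=.
  rewrite sigmaD // sigmaZ // [_ *: _]mulfVK ?sigma_r // sigmaB //.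
  by rewrite addrC subrK.
have il := ltn_trans ilt ltn0.
have rE : sigma i (phi n - newton_interp n (phi n)) = 0.
  by rewrite (sigmaB il) (IH (phi n) (ltnW ltn0) ilt) subrr.
by rewrite (sigmaD il) (sigmaZ il) rE [_ *: _]mulr0 addr0 (IH f (ltnW ltn0) ilt).
Qed.

(** By induction J_n g = 0 and J_n fixes g - a phi_n, whence g = a r_n; applying sigma_n gives a =
    0. *)
Lemma geim_space_eq0 n g : (n <= n0)%N -> geim_space phi n g ->
  (forall i, (i < n)%N -> sigma i g = 0) -> g = 0.
Proof.
elim: n g => [|n IH] g ltn0; first by move=> /geim_space0.
move=> gX g0; have [a gaX] := geim_space_recr gX.
have ln0 := ltnW ltn0.
have Jg : newton_interp n g = 0.
  apply: IH => // [|i ilt]; first exact: newton_interp_space.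
  by rewrite newton_interpP // g0 // ltnS ltnW.
have JB x y : newton_interp n (x - y) = newton_interp n x - newton_interp n y.
  exact: (zmod_morphism_linear (newton_interp_linear ln0)).
have JZ b x : newton_interp n (b *: x) = b *: newton_interp n x.
  exact: (scalable_linear (newton_interp_linear ln0)).
have Jga : newton_interp n (g - a *: phi n) = g - a *: phi n.
  apply/eqP; rewrite -subr_eq0; apply/eqP/IH => // [|i ilt].
    by apply: submod_setB => //; exact: newton_interp_space.
  rewrite sigmaB ?(leq_trans ilt) // newton_interpP // subrr //.
have gE : g = a *: r n.
  move: Jga; rewrite JB Jg sub0r JZ => /esym/eqP.
  by rewrite subr_eq addrC -scalerBr => /eqP.
have := g0 n (ltnSn n); rewrite gE sigmaZ // => /eqP.
by rewrite scaler_eq0 (negPf (sigma_r ltn0)) orbF => /eqP ->; rewrite scale0r.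
Qed.

(** The Newton form is an interpolant, so [xget] never takes its default value, and [geim_space_eq0]
    applies to the difference of two interpolants. *)
Lemma geim_interpE n f : (n <= n0)%N ->
  geim_interp phi sigma n f = newton_interp n f.
Proof.
move=> nn0; rewrite /geim_interp; case: xgetP => [g _ [gX gP]|].
  apply/eqP; rewrite -subr_eq0; apply/eqP/(geim_space_eq0 nn0).
    by apply: submod_setB => //; exact: newton_interp_space.
  move=> i ilt; rewrite sigmaB ?(leq_trans ilt) // gP // newton_interpP //.
  exact: subrr.
move=> /(_ (newton_interp n f)) []; split; first exact: newton_interp_space.
by move=> i ilt; exact: newton_interpP.
Qed.

(** A crude constant, which makes finite the suprema over F and in the operator norm. *)
Lemma newton_interp_bounded n : (n <= n0)%N ->
  (forall i f, (i < n0)%N -> `|sigma i f| <= `|f|) ->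
  exists2 C, 0 <= C & forall f, `|newton_interp n f| <= C * `|f|.
Proof.
move=> + sb; elim: n => [|n IH] ltn0; first by exists 0 => // f; rewrite normr0 mul0r.
have [C C0 Cb] := IH (ltnW ltn0).
exists (C + (1 + C) * (`|r n| / `|sigma n (r n)|)) => [|f].
  by rewrite addr_ge0 ?mulr_ge0 ?invr_ge0 ?addr_ge0.
rewrite /= (le_trans (ler_normD _ _)) // mulrDl lerD ?Cb //.
have sigmaf : `|sigma n (f - newton_interp n f)| <= (1 + C) * `|f|.
  rewrite (le_trans (sb _ _ ltn0)) // (le_trans (ler_normB _ _)) //.
  by rewrite mulrDl mul1r lerD.
rewrite normrZ normrM normfV mulrAC -mulrA [leRHS]mulrAC.
by rewrite ler_wpM2r // divr_ge0.
Qed.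

End Interpolation.

Lemma index_le_trans m n N : (m <= n)%N -> index_le n N -> index_le m N.
Proof. by case: N => //= M; exact: leq_trans. Qed.

(** If the quotients were unbounded, the real-valued supremum would default to 0, contradicting norm
    1. *)
Lemma dictionary_le (R : realType) (X : completeNormedModType R)
    (S : set (X -> R^o)) (F : set X) s f :
  dictionary S F -> S s -> `|s f| <= `|f|.
Proof.
move=> dict Ss; have [lin _] := dictionary_dual dict Ss.
have s1 := dictionary_norm1 dict Ss.
rewrite -[leRHS]mul1r -s1; apply: norm_le_opnorm.
  by rewrite -(subrr 0) (zmod_morphism_linear lin) subrr.
apply: contrapT => nub; move: s1; rewrite /opnorm sup_out; last by case.
by move/eqP; rewrite eq_sym oner_eq0.
Qed.

(** * Well-posedness and weak greedy property of the run *)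

Section GreedyRun.
Context {R : realType} {X : completeNormedModType R}.
Variables (N : option nat) (eta : R) (F : set X) (Sigma : set (X -> R^o))
  (Fs : nat -> set X) (Sigmas : nat -> set (X -> R^o))
  (phi : nat -> X) (sigma : nat -> X -> R^o).
Hypotheses (eta_gt0 : 0 < eta) (F_le1 : forall f, F f -> `|f| <= 1)
  (dim_F : dim_gt (lspan F) N) (Sigma_dict : dictionary Sigma F)
  (run : geim_run N eta F Sigma Fs Sigmas phi sigma).

Local Notation J := (geim_interp phi sigma).
Local Notation Lambda := (lebesgue_constant phi sigma).
Local Notation Xn := (geim_space phi).

Let Xsub n : submod_closed (mem (Xn n)).
Proof. exact: lspan_submod. Qed.

(** Makes the choice of [phi 0] and [sigma 0] the case n = 0 of the general step. *)
Lemma geim_interp0 f : J 0 f = 0.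
Proof. by rewrite (@geim_interpE _ _ _ _ 0). Qed.

Lemma run_argmax_phi n : index_le n N ->
  argmax (Fs n) (fun f => `|f - J n f|) (phi n).
Proof.
move=> nN; have [n0|n_gt0] := posnP n; last exact: (run_phi run).
rewrite n0; have [Fphi phiP] := run_phi0 run.
by split=> // f Ff; rewrite !geim_interp0 !subr0; exact: phiP.
Qed.

Lemma run_argmax_sigma n : index_le n N ->
  argmax (Sigmas n) (fun s => `|s (phi n - J n (phi n))|) (sigma n).
Proof.
move=> nN; have [n0|n_gt0] := posnP n; last exact: (run_sigma run).
rewrite n0; have [Ss sP] := run_sigma0 run.
by split=> // f Ff; rewrite !geim_interp0 !subr0; exact: sP.
Qed.

Lemma run_F_phi n : index_le n N -> F (phi n).
Proof. by move=> nN; apply: (run_F_sub run nN); have [] := run_argmax_phi nN. Qed.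

Lemma run_Sigma_sigma n : index_le n N -> Sigma (sigma n).
Proof. by move=> nN; apply: (run_S_sub run nN); have [] := run_argmax_sigma nN. Qed.

Lemma run_sigma_linear n : index_le n N -> linear (sigma n).
Proof. by move=> /run_Sigma_sigma/(dictionary_dual Sigma_dict)[]. Qed.

Lemma run_sigma_le n f : index_le n N -> `|sigma n f| <= `|f|.
Proof. by move=> /run_Sigma_sigma; exact: dictionary_le Sigma_dict. Qed.

(** The constant C keeps the errors over F bounded, so that their supremum dominates each of them;
    the argmax turns the supremum over F_n into the error of phi_n. *)
Lemma run_weak_greedy n C f : index_le n N ->
  (forall g, `|J n g| <= C * `|g|) -> F f ->
  eta * `|f - J n f| <= `|phi n - J n (phi n)|.
Proof.
move=> nN JC Ff; have [Fphi phiP] := run_argmax_phi nN.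
have supFs : sup [set `|f - J n f| | f in Fs n] <= `|phi n - J n (phi n)|.
  apply: ge_sup; first by exists `|phi n - J n (phi n)|, (phi n).
  by move=> _ [g Fg <-]; exact: phiP.
apply: le_trans supFs.
suff: eta * sup [set `|f - J n f| | f in F] <= sup [set `|f - J n f| | f in Fs n].
  apply: le_trans; rewrite ler_pM2l //; apply: ub_le_sup; last by exists f.
  exists (1 + `|C|) => _ [g Fg <-]; apply: le_trans (ler_normB _ _) _.
  apply: lerD; first exact: F_le1.
  apply: le_trans (JC g) _; have := F_le1 Fg; have := ler_norm C.
  have := normr_ge0 g; have := normr_ge0 C; nra.
have [n0|n_gt0] := posnP n; last exact: (run_weak run).
have absE A : [set `|f - J 0 f| | f in A] = [set `|f| | f in A].
  by apply: eq_imagel => g _; rewrite geim_interp0 subr0.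
by rewrite n0 !absE; exact: run_weak0 run.
Qed.

(** Otherwise every functional of [Sigmas n] would vanish on the residual of phi_n, which would be 0
    by (P2); the weak greedy inequality would then put F inside X_n, against dim span F > N >= n. *)
Lemma run_sigma_neq0 n : index_le n N ->
  sigma n (phi n - newton_interp phi sigma n (phi n)) != 0.
Proof.
elim/ltn_ind: n => n IH nN.
have le_nN i : (i < n)%N -> index_le i N.
  by move=> ilt; exact: index_le_trans (ltnW ilt) nN.
have slin i (ilt : (i < n)%N) := run_sigma_linear (le_nN i ilt).
have sneq0 i (ilt : (i < n)%N) := IH i ilt (le_nN i ilt).
have JE f := geim_interpE slin sneq0 f (leqnn n).
apply/negP => /eqP; rewrite -JE => s0.
have [Ss sP] := run_argmax_sigma nN.
have JX f : Xn n (J n f) by rewrite JE; exact: newton_interp_space.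
have r0 : phi n - J n (phi n) = 0.
  apply: (run_separating run nN) => [|s /sP].
    (* Nestedness puts phi_0, ..., phi_n in F_n, so the residual lies in the span of F_n. *)
    have phiF i : (i <= n)%N -> Fs n (phi i).
      move=> ilt; have iN := index_le_trans ilt nN.
      by apply: (run_F_nested run ilt nN); have [] := run_argmax_phi iN.
    have Fsub := lspan_submod (Fs n).
    apply: submod_setB => //; first by apply: sub_lspan; exact: phiF.
    apply: lspan_subset (JX (phi n)) => _ [i /= ilt <-].
    by apply: phiF; exact: ltnW.
  by rewrite s0 normr0 normr_le0 => /eqP.
have [C C0 JC] := newton_interp_bounded phi (leqnn n)
  (fun i f ilt => run_sigma_le f (le_nN i ilt)).
have FX : F `<=` Xn n.
  move=> f Ff; have := run_weak_greedy nN (C := C) _ Ff; rewrite r0 normr0.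
  rewrite pmulr_rle0 // normr_le0 subr_eq0 => H.
  by rewrite (eqP (H _)) => // g; rewrite JE.
apply: (@geim_space_dim _ _ phi n).
have [v [Fv vfree]] : dim_ge (lspan F) n.+1.
  by case: (N) nN dim_F => [M|] //= nM; exact: dim_ge_leq.
by exists v; split=> // i; apply: lspan_min FX _ (Fv i).
Qed.

Section Step.
Variable n : nat.
Hypothesis nN : index_le n N.

Let le_nN i : (i < n)%N -> index_le i N.
Proof. by move=> /ltnW ilt; exact: index_le_trans ilt nN. Qed.

Let JE f : J n f = newton_interp phi sigma n f.
Proof.
apply: (@geim_interpE _ _ _ _ n) => // i /le_nN iN; first exact: run_sigma_linear.
exact: run_sigma_neq0.
Qed.

Let JX f : Xn n (J n f).
Proof. by rewrite JE; exact: newton_interp_space. Qed.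

Let J_linear : linear (J n).
Proof.
move=> k x y; rewrite !JE; apply: newton_interp_linear (leqnn n) k x y => i /le_nN.
exact: run_sigma_linear.
Qed.

Lemma geim_interp_le f : `|J n f| <= Lambda n * `|f|.
Proof.
apply: norm_le_opnorm; first by have := zmod_morphism_linear J_linear 0 0; rewrite !subrr.
have [C C0 JC] := newton_interp_bounded phi (leqnn n)
  (fun i f ilt => run_sigma_le f (le_nN ilt)).
exists C => _ [g g0 <-]; rewrite JE ler_pdivrMr ?normr_gt0 //.
Qed.

(** J_n fixes X_n, so f - J_n f = (f - v) - J_n (f - v) for every v in X_n. *)
Lemma geim_error_le_dist f :
  `|f - J n f| <= (1 + Lambda n) * dist_to (Xn n) f.
Proof.
have L0 : 0 < 1 + Lambda n by rewrite ltr_wpDr ?opnorm_ge0.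
rewrite mulrC -ler_pdivrMr //; apply: dist_to_lub => // v Xv.
rewrite ler_pdivrMr //.
have Jv : J n v = v.
  apply/eqP; rewrite -subr_eq0; apply/eqP.
  have slin i (ilt : (i < n)%N) := run_sigma_linear (le_nN ilt).
  have sneq0 i (ilt : (i < n)%N) := run_sigma_neq0 (le_nN ilt).
  apply: (geim_space_eq0 slin sneq0 (leqnn n)).
    by apply: submod_setB.
  move=> i ilt; rewrite (zmod_morphism_linear (slin i ilt)) JE.
  by rewrite (newton_interpP slin sneq0 _ (leqnn n) ilt) subrr.
have -> : f - J n f = (f - v) - J n (f - v).
  by rewrite (zmod_morphism_linear J_linear) Jv opprB addrA subrK.
rewrite (le_trans (ler_normB _ _)) // mulrDr mulr1 mulrC.
by rewrite lerD // geim_interp_le.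
Qed.

(** The distance of f is at most its error; eta times that is at most the error of phi_n, itself at
    most 1 + Lambda_n times the distance of phi_n. *)
Lemma geim_weak_greedy f : F f ->
  geim_gamma eta phi sigma n * dist_to (Xn n) f <= dist_to (Xn n) (phi n).
Proof.
move=> Ff; have L0 : 0 < 1 + Lambda n by rewrite ltr_wpDr ?opnorm_ge0.
rewrite /geim_gamma mulrAC ler_pdivrMr // mulrC.
apply: le_trans (le_trans (run_weak_greedy nN geim_interp_le Ff) _).
  by rewrite mulrC ler_pM2l //; exact: dist_to_le.
by rewrite mulrC; exact: geim_error_le_dist.
Qed.

End Step.

End GreedyRun.

(** * Weak greedy algorithms and widths *)

Section Width.
Context {R : realType} {X : completeNormedModType R}.
Variables (F : set X).
Hypothesis F_le1 : forall f, F f -> `|f| <= 1.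

Definition sup_dist (Y : set X) : R := sup [set dist_to Y u | u in F].

Lemma has_ubound_dist_to Y :
  submod_closed (mem Y) -> has_ubound [set dist_to Y u | u in F].
Proof.
move=> Ysub; exists 1 => _ [f Ff <-].
exact: le_trans (dist_to_norm Ysub f) (F_le1 Ff).
Qed.

Lemma dist_to_le_sup Y f :
  submod_closed (mem Y) -> F f -> dist_to Y f <= sup_dist Y.
Proof.
by move=> Ysub Ff; apply: ub_le_sup (has_ubound_dist_to Ysub) _ _; exists f.
Qed.

Lemma sup_dist_ge0 Y : submod_closed (mem Y) -> 0 <= sup_dist Y.
Proof. by move=> Ysub; apply: sup_ge0 => _ [f _ <-]; exact: dist_to_ge0. Qed.

Lemma sup_dist_le Y c : 0 <= c ->
  (forall f, F f -> dist_to Y f <= c) -> sup_dist Y <= c.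
Proof.
move=> c0 Yc; have [F0|/set0P[f Ff]] := eqVneq F set0.
  by rewrite /sup_dist F0 image_set0 sup0.
apply: ge_sup; first by exists (dist_to Y f); exists f.
by move=> _ [g Fg <-]; exact: Yc.
Qed.

Lemma sup_dist_subset Y Z : submod_closed (mem Y) -> submod_closed (mem Z) ->
  Y `<=` Z -> sup_dist Z <= sup_dist Y.
Proof.
move=> Ysub Zsub YZ; apply: sup_dist_le; first exact: sup_dist_ge0.
move=> f Ff; apply: le_trans (dist_to_le_sup Ysub Ff).
exact: dist_to_subset.
Qed.

Lemma kolmogorov_width_ge0 n : 0 <= kolmogorov_width F n.
Proof.
have [|/inf_out] := pselect (has_inf [set sup_dist Y | Y in
    [set Y : set X | submod_closed (mem Y) /\ dim_le Y n]]); last first.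
  by rewrite /kolmogorov_width => ->.
move=> [ne _]; apply: lb_le_inf => // _ [Y [Ysub _] <-]; exact: sup_dist_ge0.
Qed.

Lemma kolmogorov_width_lt n c : kolmogorov_width F n < c ->
  exists Y, [/\ submod_closed (mem Y), dim_le Y n &
    forall f, F f -> exists2 h, Y h & `|f - h| < c].
Proof.
move=> /inf_lt[|_ [Y [Ysub Yn] <-] Yc].
  (* The zero space shows that the infimum is over a nonempty set. *)
  have Xsub := lspan_submod (set0 : set X).
  exists (sup_dist (lspan (set0 : set X))), (lspan set0) => //; split=> //.
  move=> [v [v0 vfree]].
  have vz i : v i = 0 by have [[|k] [a [w [Aw ->]]]] := v0 i; [rewrite big_ord0|case: (Aw ord0)].
  have := vfree (fun=> 1) _ ord0; rewrite big1 => [|i _]; last by rewrite vz scaler0.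
  by move=> /(_ erefl)/eqP; rewrite oner_eq0.
exists Y; split=> // f Ff; apply: dist_to_lt => //.
exact: le_lt_trans (dist_to_le_sup Ysub Ff) Yc.
Qed.

Variable phi : nat -> X.
Local Notation Xn := (geim_space phi).
Local Notation s n := (sup_dist (geim_space phi n)).

Let Xsub n : submod_closed (mem (Xn n)).
Proof. exact: lspan_submod. Qed.

Lemma sup_dist_geim_le m n : (m <= n)%N -> s n <= s m.
Proof. by move=> mn; apply: sup_dist_subset => //; exact: geim_space_le. Qed.

Lemma sup_dist_le1 Y : submod_closed (mem Y) -> sup_dist Y <= 1.
Proof.
move=> Ysub; apply: sup_dist_le => // f Ff.
exact: le_trans (dist_to_norm Ysub f) (F_le1 Ff).
Qed.

Lemma weak_greedy_det m n0 d : (0 < m)%N -> kolmogorov_width F m < d ->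
  (forall i, (n0 < i <= n0 + 2 * m)%N -> F (phi i)) ->
  \prod_(i < 2 * m) dist_to (Xn (n0 + i.+1)) (phi (n0 + i.+1)) <=
  (4 * m%:R * s n0.+1 * d) ^+ m.
Proof.
move=> m0 /[dup] dm /kolmogorov_width_lt[Y [Ysub Ym Yd]] Fphi.
have d0 : 0 < d := le_lt_trans (kolmogorov_width_ge0 m) dm.
pose p (i : 'I_(2 * m)) := phi (n0 + i.+1).
have Fp i : F (p i) by apply: Fphi; have := ltn_ord i; lia.
have /choice[h hP] : forall i, exists h, Y h /\ `|p i - h| < d.
  by move=> i; have [h Yh hd] := Yd _ (Fp i); exists h.
pose D (j : 'I_(2 * m)) := dist_to (Xn (n0 + j.+1)).
(* For functional j, which vanishes on X_(n0+j+1), [c j] lists the values at the [p i] and [e j]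
   those at their approximations [h i]. *)
have /choice[c /choice[e ceP]] : forall j, exists c e : 'I_(2 * m) -> R,
    [/\ c j = D j (p j), forall i, `|c i| <= D j (p i),
      forall i, `|c i - e i| <= D j (p i - h i) &
      forall a : 'I_(2 * m) -> R,
        `|\sum_i a i * e i| <= D j (\sum_i a i *: h i)].
  by move=> j; apply: hahn_banach_approx => *; [exact: dist_toD|exact: dist_toZ].
pose G := \matrix_(i, j) c j i.
pose H := \matrix_(i, j) e j i.
have s0 : 0 <= s n0.+1 by exact: sup_dist_ge0.
have Gle i j : `|G i j| <= D j (p i) by rewrite mxE; have [_ + _ _] := ceP j.
have GHle i j : `|(G - H) i j| <= d.
  rewrite !mxE; have [_ _ + _] := ceP j; move=> /(_ i)/le_trans; apply.
  apply: le_trans (dist_to_norm (Xsub _) _) (ltW _); exact: (hP i).2.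
(* For i < j, [p i] lies in X_(n0+j+1), where functional j vanishes. *)
have Gtrig : is_trig_mx G.
  apply/is_trig_mxP => i j ij; apply/eqP; rewrite -normr_le0.
  apply: le_trans (Gle i j) _; rewrite /D dist_to_eq0 //.
  by apply: geim_space_phi; rewrite ltn_add2l ltnS.
have GS i j : `|G i j| <= s n0.+1.
  apply: le_trans (Gle i j) _; apply: le_trans (dist_to_le_sup (Xsub _) (Fp i)) _.
  by apply: sup_dist_geim_le; lia.
(* More than m independent rows of H would come from as many independent vectors [h i] of Y, since a
   relation among these carries over to the rows. *)
have rankH : (\rank H <= m)%N.
  rewrite leqNgt; apply/negP => mH; apply: Ym; apply: (dim_ge_leq mH).
  pose g := maxrankfun H; exists (h \o g); split=> [i|a a0]; first exact: (hP _).1.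
  suff aH : (\row_k a k) *m rowsub g H = 0.
    move=> i; have : \row_k a k = 0 by apply: (row_free_inj (maxrowsub_free H)); rewrite mul0mx.
    by move=> /rowP/(_ i); rewrite !mxE.
  apply/rowP => j; rewrite !mxE; under eq_bigr do rewrite !mxE.
  apply/eqP; rewrite -normr_le0.
  (* The coefficients of the selected rows, extended by 0 to all indices. *)
  pose b i := \sum_(k | g k == i) a k.
  have [_ _ _ /(_ b)] := ceP j.
  have -> : \sum_i b i *: h i = 0.
    rewrite -[RHS]a0 /b; under eq_bigr do rewrite scaler_suml.
    rewrite (exchange_big_dep predT) //=; apply: eq_bigr => k _.
    by rewrite (big_pred1 (g k)) // => i; rewrite /= eq_sym.
  have -> : \sum_i b i * e j i = \sum_k a k * e j (g k).
    rewrite /b; under eq_bigr do rewrite mulr_suml.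
    rewrite (exchange_big_dep predT) //=; apply: eq_bigr => k _.
    by rewrite (big_pred1 (g k)) // => i; rewrite /= eq_sym.
  by rewrite {1}/D dist_to_eq0 //; exact: submod_set0.
rewrite -[leRHS]ger0_norm; last by rewrite exprn_ge0 ?mulr_ge0 ?(ltW d0).
rewrite -[leLHS]ger0_norm; last by apply: prodr_ge0 => i _; exact: dist_to_ge0.
rewrite -ler_sqr ?nnegrE // !real_normK ?num_real //.
have <- : \det G = \prod_(i < 2 * m) dist_to (Xn (n0 + i.+1)) (phi (n0 + i.+1)).
  by rewrite det_trig //; apply: eq_bigr => i _; rewrite mxE; have [-> _ _ _] := ceP i.
(* Entries bounded by s and d give squared norms at most (2m)^2 s^2 and (2m)^2 d^2; hence this
   choice of A and B, with 4 A B = (4 m s d)^2. *)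
have := @det_near_low_rank R m G H ((2 * m)%:R * s n0.+1 ^+ 2)
  ((2 * m)%:R * d ^+ 2) m0 rankH.
rewrite [in X in _ -> X]exprAC.
have -> : 4 * ((2 * m)%:R * s n0.+1 ^+ 2) * ((2 * m)%:R * d ^+ 2) =
    (4 * m%:R * s n0.+1 * d) ^+ 2.
  by rewrite natrM; ring.
apply.
- by rewrite mulr_ge0 ?exprn_ge0.
- by rewrite mulr_gt0 ?exprn_gt0 // ltr0n muln_gt0.
- exact: sqnorm_mx_le.
- by apply: sqnorm_mx_le => //; exact: ltW.
Qed.

(** As s is nonincreasing, each distance in the product is at least gamma_i s_(n0+2m); the claim is
    the m-th root of the determinant bound. *)
Lemma weak_greedy_width m n0 (gamma : nat -> R) (G : R) : (0 < m)%N ->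
  (forall i, (n0 < i <= n0 + 2 * m)%N -> [/\ F (phi i), 0 <= gamma i &
     gamma i * s i <= dist_to (Xn i) (phi i)]) ->
  0 <= G -> G ^+ (2 * m) = \prod_(i < 2 * m) gamma (n0 + i.+1)%N ->
  (G * s (n0 + 2 * m)%N) ^+ 2 <= 4 * m%:R * s n0.+1 * kolmogorov_width F m.
Proof.
move=> m0 gammaP G0 GE; have sn0 n : 0 <= s n by exact: sup_dist_ge0.
(* The slack e added to the width is removed after dividing by s_(n0+1), so the value 0 is treated
   apart. *)
have [sz|s1] := eqVneq (s n0.+1) 0.
  have -> : s (n0 + 2 * m)%N = 0.
    by apply/le_anti; rewrite sn0 andbT -sz sup_dist_geim_le //; lia.
  by rewrite sz !mulr0 mul0r expr0n.
have K0 : 0 < 4 * m%:R * s n0.+1.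
  by rewrite mulr_gt0 ?mulr_gt0 ?ltr0n // lt0r s1 sn0.
rewrite [leRHS]mulrC -ler_pdivrMr //; apply/ler_addgt0Pr => e e0.
rewrite ler_pdivrMr // [leRHS]mulrC.
have := @weak_greedy_det m n0 (kolmogorov_width F m + e) m0.
rewrite ltrDl => /(_ e0 (fun i iP => let: And3 Fi _ _ := gammaP i iP in Fi)) detP.
rewrite -(@ler_pXn2r _ m) // ?nnegrE ?exprn_ge0 ?mulr_ge0 //; last first.
  by rewrite addr_ge0 ?(ltW e0) ?kolmogorov_width_ge0.
rewrite -exprM exprMn GE; apply: le_trans detP.
rewrite -[X in _ * _ ^+ X]card_ord -prodr_const -big_split /=.
apply: ler_prod => i _.
have iP : (n0 < n0 + i.+1 <= n0 + 2 * m)%N by have := ltn_ord i; lia.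
have [_ g0 gP] := gammaP _ iP; rewrite mulr_ge0 //=.
apply: le_trans gP; rewrite ler_wpM2l // sup_dist_geim_le //; lia.
Qed.

(** If |phi_0| <= 2 d, every f in F has norm at most 2 d / eta. Otherwise a nearly optimal Y is a
    line through some y0 close to phi_0, and f, close to c y0, is approximated by c phi_0 with error
    at most d + |c| d, where |c| <= 1 + 2 / eta. *)
Lemma weak_greedy_first eta : 0 < eta -> F (phi 0%N) ->
  (forall f, F f -> eta * `|f| <= `|phi 0%N|) ->
  s 1%N <= 2 * (1 + eta^-1) * kolmogorov_width F 1.
Proof.
move=> eta0 F0 phi0.
have Ce : 0 < 2 * (1 + eta^-1) by rewrite mulr_gt0 // addr_gt0 ?invr_gt0.
rewrite [leRHS]mulrC -ler_pdivrMr //; apply/ler_addgt0Pr => e e0.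
rewrite ler_pdivrMr // [leRHS]mulrC.
set d := kolmogorov_width F 1 + e.
have dlt : kolmogorov_width F 1 < d by rewrite ltrDl.
have d0 : 0 < d := le_lt_trans (kolmogorov_width_ge0 1) dlt.
have [Y [Ysub Y1 Yd]] := kolmogorov_width_lt dlt.
apply: sup_dist_le; first by rewrite mulr_ge0 // ltW.
move=> f Ff; have phif : `|f| <= `|phi 0%N| / eta by rewrite ler_pdivlMr // mulrC phi0.
have [phid|phid] := leP `|phi 0%N| (2 * d).
  apply: le_trans (dist_to_norm (Xsub 1) f) (le_trans phif _).
  rewrite ler_pdivrMr //; apply: le_trans phid _.
  have -> : 2 * (1 + eta^-1) * d * eta = 2 * d * (eta + 1) by field; rewrite gt_eqF.
  by rewrite ler_peMr ?mulr_ge0 ?(ltW d0) // lerDr ltW.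
have [y0 Yy0 y0d] := Yd _ F0; have [y Yy yd] := Yd _ Ff.
have ny0 : `|phi 0%N| - d <= `|y0|.
  by rewrite lerBlDr -lerBlDl (le_trans (lerB_dist _ _)) // ltW.
have y0_gt0 : 0 < `|y0| by apply: lt_le_trans ny0; lra.
have [c yE] : exists c, y = c *: y0.
  apply: contrapT => yc; apply: Y1.
  exists (fun i : 'I_2 => if i == 0 then y0 else y); split=> [i|a]; first by case: ifP.
  rewrite !big_ord_recl big_ord0 /= addr0 => a0.
  have a1z : a (lift ord0 ord0) = 0.
    apply: contrapT => /eqP a1; apply: yc.
    exists (- (a (lift ord0 ord0))^-1 * a ord0); rewrite -scalerA.
    apply: (@scalerI _ _ (a (lift ord0 ord0))) => //.
    rewrite [RHS]scalerA mulrN divff // scaleN1r; apply/eqP.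
    by rewrite -addr_eq0 addrC a0.
  move: a0; rewrite a1z scale0r addr0 => /eqP; rewrite scaler_eq0.
  rewrite -[y0 == 0]normr_eq0 (gt_eqF y0_gt0) orbF => /eqP a0z i.
  by case: i => [[|[|//]] ilt]; [rewrite -a0z|rewrite -a1z]; congr (a _); apply/val_inj.
have Xc : Xn 1 (c *: phi 0%N) by apply: submod_setZ => //; exact: geim_space_phi.
apply: le_trans (dist_to_le _ Xc) _.
have -> : f - c *: phi 0%N = (f - y) + c *: (y0 - phi 0%N).
  by rewrite scalerBr -yE addrA subrK.
apply: le_trans (ler_normD _ _) _; rewrite normrZ (distrC y0).
(* With u = 1 / eta, this reduces to (1 + u) (|phi_0| - 2 d) >= 0. *)
have cb : `|c| <= 1 + 2 / eta.
  rewrite -(ler_pM2r y0_gt0) -normrZ -yE.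
  have yf : `|y| <= `|phi 0%N| * eta^-1 + d.
    by rewrite -[y](subrK f) addrC (le_trans (ler_normD _ _)) // lerD // distrC ltW.
  apply: (le_trans yf); have u0 : 0 < eta^-1 by rewrite invr_gt0.
  move: u0 ny0 phid d0; set u := eta^-1; set P := `|phi 0%N|; set q := `|y0|.
  move=> u0 qP Pd d0; have : (1 + 2 * u) * (P - d) <= (1 + 2 * u) * q.
    by rewrite ler_wpM2l // addr_ge0 // mulr_ge0 // ltW.
  apply: le_trans; nra.
have : `|c| * `|phi 0%N - y0| <= (1 + 2 / eta) * d.
  by apply: ler_pM => //; exact: ltW.
by move: yd; set u := eta^-1; set z := `|f - y|; set t := _ * `|_|; nra.
Qed.

End Width.

(** * Decay rates *)

(** The block of [ell2 l k] indices that follows n0 = ell_1 - ceil(k / 4) ends exactly at n. *)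
Lemma ell_sum l k : (k < 4)%N -> (2 <= 4 * l + k)%N ->
  (ell1 l k - (k + 3) %/ 4 + ell2 l k)%N = (4 * l + k)%N.
Proof. by rewrite /ell1 /ell2; lia. Qed.

Lemma ell1_gt0 l k : (k < 4)%N -> (2 <= 4 * l + k)%N -> (0 < ell1 l k)%N.
Proof. by rewrite /ell1; lia. Qed.

Lemma ell1_lt l k : (k < 4)%N -> (2 <= 4 * l + k)%N -> (ell1 l k < 4 * l + k)%N.
Proof. by rewrite /ell1; lia. Qed.

Lemma ell2_gt0 l k : (2 <= 4 * l + k)%N -> (0 < l + (k + 3) %/ 4)%N.
Proof. lia. Qed.

Lemma ell1_le l k : (k < 4)%N -> (ell1 l k <= (ell1 l k - (k + 3) %/ 4).+1)%N.
Proof. by move=> k4; have : ((k + 3) %/ 4 <= 1)%N; lia. Qed.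

(** The source of the factor (2 sqrt 2)^alpha: the product of ell_1 and m = ell_2 / 2 is at least
    n^2 / 8, with equality for k = 0. *)
Lemma sqr_le_ell l k : (k < 4)%N -> (2 <= 4 * l + k)%N ->
  ((4 * l + k) ^ 2 <= 8 * (ell1 l k * (l + (k + 3) %/ 4)))%N.
Proof.
rewrite /ell1 -mulnn.
case: k => [|[|[|[|//]]]] _ /= h.
- have -> : ((2 * 0) %/ 3 = 0)%N by []. have -> : ((0 + 3) %/ 4 = 0)%N by [].
  by apply/eq_leq; ring.
- have -> : ((2 * 1) %/ 3 = 0)%N by []. have -> : ((1 + 3) %/ 4 = 1)%N by [].
  (* As n >= 2, k = 1 forces l >= 1, so the predecessor is not truncated. *)
  have -> : (8 * ((2 * l + 0) * (l + 1)) = (4 * l + 1) * (4 * l + 1) + (8 * l).-1)%N by nia.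
  exact: leq_addr.
- have -> : ((2 * 2) %/ 3 = 1)%N by []. have -> : ((2 + 3) %/ 4 = 1)%N by [].
  have -> : (8 * ((2 * l + 1) * (l + 1)) = (4 * l + 2) * (4 * l + 2) + (8 * l + 4))%N by ring.
  exact: leq_addr.
have -> : ((2 * 3) %/ 3 = 2)%N by []. have -> : ((3 + 3) %/ 4 = 1)%N by [].
have -> : (8 * ((2 * l + 2) * (l + 1)) = (4 * l + 3) * (4 * l + 3) + (8 * l + 7))%N by ring.
exact: leq_addr.
Qed.

Lemma half_bounds n : (2 <= n)%N ->
  [/\ 0 < n %/ 2, 2 * (n %/ 2) <= n & n <= 4 * (n %/ 2)]%N.
Proof. by move=> n2; split; lia. Qed.

Section PowerBounds.
Context {R : realType}.

Lemma powRN_prod_le (a b n : nat) (alpha : R) : 0 < alpha ->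
  (0 < n)%N -> (n ^ 2 <= 8 * (a * b))%N ->
  a%:R `^ (- alpha) * b%:R `^ (- alpha) <=
  ((2 * Num.sqrt 2) `^ alpha * n%:R `^ (- alpha)) ^+ 2.
Proof.
move=> alpha0 n0 nab.
have ab0 : (0 < a * b)%N by move: nab; case: (a * b)%N => //; rewrite muln0; lia.
have x0 : 0 < (a * b)%:R `^ alpha :> R by rewrite powR_gt0 // ltr0n.
have y0 : 0 < n%:R `^ alpha :> R by rewrite powR_gt0 // ltr0n.
have E8 : ((2 * Num.sqrt 2) `^ alpha) ^+ 2 = 8 `^ alpha :> R.
  rewrite expr2 -powRM ?mulr_ge0 //; congr (_ `^ _).
  by rewrite -expr2 exprMn sqr_sqrtr //; ring.
rewrite exprMn E8 !powRN -invfM -powRM // -natrM exprVn.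
rewrite ler_pdivlMr ?exprn_gt0 // mulrC ler_pdivrMr // expr2 -!powRM //.
have nab' : n%:R * n%:R <= 8 * (a * b)%:R :> R by rewrite -!natrM ler_nat mulnn.
by rewrite ge0_ler_powR ?nnegrE ?mulr_ge0 ?(ltW alpha0).
Qed.

Lemma prod_rootX (gamma : nat -> R) (n0 K : nat) : (0 < K)%N ->
  (forall i, 0 <= gamma i) ->
  (\prod_(1 <= i < K.+1) gamma (n0 + i)%N `^ K%:R^-1) ^+ K =
  \prod_(i < K) gamma (n0 + i.+1)%N.
Proof.
move=> K0 gamma0; rewrite big_add1 big_mkord -prodrXl; apply: eq_bigr => i _.
by rewrite -powR_mulrn ?powR_ge0 // -powRrM mulVf ?powRr1 // pnatr_eq0 -lt0n.
Qed.

Lemma prod_root_gt0 (gamma : nat -> R) (n0 K : nat) :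
  (forall i, 0 < gamma i) ->
  0 < \prod_(1 <= i < K.+1) gamma (n0 + i)%N `^ K%:R^-1.
Proof. by move=> gamma0; apply: prodr_gt0 => i _; exact: powR_gt0. Qed.

End PowerBounds.

(** * Convergence rates from a weak greedy inequality with factors gamma_n *)

Section GreedyRates.
Context {R : realType} {X : completeNormedModType R}.
Variables (N : option nat) (eta : R) (F : set X) (phi : nat -> X)
  (gamma : nat -> R) (C0 alpha c1 : R).
Hypotheses (eta_gt0 : 0 < eta) (F_le1 : forall f, F f -> `|f| <= 1)
  (N_ge0 : index_le 0 N) (F_phi : forall n, index_le n N -> F (phi n))
  (phi0 : forall f, F f -> eta * `|f| <= `|phi 0%N|)
  (gamma_gt0 : forall n, 0 < gamma n)
  (gammaP : forall n, index_le n N -> gamma n * sup_dist F (geim_space phi n)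
     <= dist_to (geim_space phi n) (phi n))
  (C0_gt0 : 0 < C0) (alpha_gt0 : 0 < alpha).

Local Notation s n := (sup_dist F (geim_space phi n)).
Local Notation d := (kolmogorov_width F).

Let s_ge0 n : 0 <= s n.
Proof. by apply: sup_dist_ge0 => //; exact: lspan_submod. Qed.

Let rate m n0 : (0 < m)%N -> index_le (n0 + 2 * m) N ->
  (\prod_(1 <= i < (2 * m).+1) gamma (n0 + i)%N `^ (2 * m)%:R^-1
     * s (n0 + 2 * m)%N) ^+ 2 <= 4 * m%:R * s n0.+1 * d m.
Proof.
move=> m0 nN; apply: (weak_greedy_width F_le1 (gamma := gamma)) => //.
- move=> i /andP[_ ile]; have iN := index_le_trans ile nN.
  by split; [exact: F_phi|exact: ltW|exact: gammaP].
- by apply: ltW; exact: prod_root_gt0.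
- by apply: prod_rootX => [|i]; [rewrite muln_gt0|exact: ltW].
Qed.

Lemma greedy_rate_alg :
  (forall n, (1 <= n)%N -> d n <= C0 * n%:R `^ (- alpha)) ->
  forall n, (1 <= n)%N -> index_le n N ->
    s n <= C0 * beta_alg eta alpha gamma n * n%:R `^ (- alpha).
Proof.
move=> dC; elim/ltn_ind => n IH n1 nN.
have [{IH}n2|n2] := leqP n 1.
  have -> : n = 1%N by apply/eqP; rewrite eqn_leq n2 n1.
  rewrite beta_alg1 powR1 mulr1.
  apply: le_trans (weak_greedy_first F_le1 eta_gt0 (F_phi N_ge0) phi0) _.
  rewrite mulrC ler_wpM2r //; last by have := dC 1%N isT; rewrite powR1 mulr1.
  by rewrite mulr_ge0 // addr_ge0 // invr_ge0 ltW.
pose l := (n %/ 4)%N; pose k := (n %% 4)%N.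
have k4 : (k < 4)%N by rewrite ltn_mod.
have nE : n = (4 * l + k)%N by rewrite mulnC -divn_eq.
have n2' : (2 <= 4 * l + k)%N by rewrite -nE.
have ell_lt := ell1_lt k4 n2'; rewrite -nE in ell_lt.
have := IH _ ell_lt (ell1_gt0 k4 n2') (index_le_trans (ltnW ell_lt) nN).
have -> : beta_alg eta alpha gamma n =
    beta_alg_step alpha gamma l k (beta_alg eta alpha gamma (ell1 l k)).
  by rewrite {1}nE beta_algE.
rewrite /beta_alg_step; set b := beta_alg _ _ _ _ => IHs.
set G := \prod_(1 <= i < _) _; set m := (l + (k + 3) %/ 4)%N.
set n0 := (ell1 l k - (k + 3) %/ 4)%N.
have m0 : (0 < m)%N by exact: ell2_gt0 n2'.
have nn0 : (n0 + 2 * m = n)%N by rewrite nE -(ell_sum k4 n2').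
have := @rate m n0 m0; rewrite nn0 => /(_ nN); rewrite -/(ell2 l k) -/G => Gs.
have G0 : 0 < G by exact: prod_root_gt0.
have s_ell : s n0.+1 <= s (ell1 l k).
  apply: sup_dist_geim_le => //; exact: ell1_le.
(* Read off from the induction hypothesis, as s is nonnegative. *)
have b0 : 0 <= b.
  have := le_trans (s_ge0 _) IHs; rewrite mulrAC pmulr_rge0 // mulr_gt0 // powR_gt0 // ltr0n.
  exact: ell1_gt0.
set S := Num.sqrt _; set P := _ `^ alpha; set Q := n%:R `^ _.
have -> : C0 * (G^-1 * S * P) * Q = G^-1 * (C0 * S * (P * Q)) by ring.
rewrite ler_pdivlMl // -ler_sqr ?nnegrE; last 2 first.
- by rewrite mulr_ge0 // ltW.
- by rewrite !mulr_ge0 ?powR_ge0 ?sqrtr_ge0 // ltW.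
apply: le_trans Gs _.
have S2 : S ^+ 2 = 4 * m%:R * b.
  by rewrite sqr_sqrtr ?mulr_ge0 // /ell2 -/m natrM; ring.
rewrite !exprMn S2.
have nm := sqr_le_ell k4 n2'; rewrite -nE -/m in nm.
have LP := powRN_prod_le alpha_gt0 n1 nm.
(* The induction hypothesis at ell_1 and the width bound at m combine; n^2 <= 8 ell_1 m then turns
   (ell_1 m)^-alpha into a multiple of n^(-2 alpha). *)
have : s n0.+1 * d m <= (C0 * b * (ell1 l k)%:R `^ (- alpha)) * (C0 * m%:R `^ (- alpha)).
  by apply: ler_pM => //; [exact: kolmogorov_width_ge0|exact: le_trans IHs|exact: dC].
move=> /(ler_wpM2l (mulr_ge0 (ler0n R 4) (ler0n R m))).
rewrite [X in X <= _]mulrA => /le_trans; apply.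
have T0 : 0 <= C0 ^+ 2 * (4 * m%:R * b) by rewrite !mulr_ge0 // ltW.
have := ler_wpM2l T0 LP; rewrite exprMn; apply: le_trans.
by rewrite le_eqVlt; apply/orP; left; apply/eqP; ring.
Qed.

Lemma greedy_rate_exp : 0 < c1 -> 1 <= C0 ->
  (forall n, (1 <= n)%N -> d n <= C0 * expR (- c1 * n%:R `^ alpha)) ->
  forall n, (1 <= n)%N -> index_le n N ->
    s n <= C0 * beta_exp eta gamma n
             * expR (- (c1 * 2 `^ (- 2 * alpha - 1)) * n%:R `^ alpha).
Proof.
move=> c1_gt0 C0_ge1 dC n n1 nN; set c2 := c1 * _.
(* By the choice of c_2, n <= 4 m gives c_1 m^alpha >= 2 c_2 n^alpha; thus C_0 times the square of
   the target exponential bounds d_m. *)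
have c2E : 2 * c2 * 4 `^ alpha = c1.
  have E4 : 4 = 2 `^ 2 :> R by rewrite powR_mulrn // expr2; ring.
  have pq : 2 `^ (- 2 * alpha - 1) * 4 `^ alpha = 2^-1 :> R.
    rewrite E4 -powRrM -powRD; last by rewrite pnatr_eq0 implybT.
    have -> : - 2 * alpha - 1 + 2 * alpha = -1 by ring.
    by rewrite powR_inv1.
  by rewrite /c2 -!mulrA pq; field.
have c2_gt0 : 0 < c2 by rewrite mulr_gt0 // powR_gt0.
(* Hence c_2 <= c_1, which settles n = 1. *)
have pow4 : 1 <= 4 `^ alpha.
  by have := @ler_powR R 4 _ _ _ (ltW alpha_gt0); rewrite powRr0; apply; rewrite ler1n.
rewrite /beta_exp; have [n1'|n2] := leqP n 1.
  have -> : n = 1%N by apply/eqP; rewrite eqn_leq n1' n1.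
  apply: le_trans (weak_greedy_first F_le1 eta_gt0 (F_phi N_ge0) phi0) _.
  rewrite [C0 * _]mulrC -[leRHS]mulrA ler_wpM2l //.
    by rewrite mulr_ge0 // addr_ge0 // invr_ge0 ltW.
  apply: le_trans (dC 1%N isT) _; rewrite ler_pM2l // ler_expR powR1 !mulr1 lerN2.
  by nra.
set m := (n %/ 2)%N; set G := \prod_(1 <= i < _) _.
have [m0 mn nm] : [/\ 0 < m, 2 * m <= n & n <= 4 * m]%N := half_bounds n2.
have Gs := @rate m 0 m0 (index_le_trans mn nN).
rewrite add0n in Gs.
have G0 : 0 < G by exact: (prod_root_gt0 0).
have sn : s n <= s (2 * m)%N by exact: sup_dist_geim_le.
set E := expR _.
have -> : C0 * (Num.sqrt 2 * G^-1 * Num.sqrt n%:R) * E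
  = G^-1 * (C0 * (Num.sqrt 2 * Num.sqrt n%:R) * E) by ring.
rewrite ler_pdivlMl // (le_trans (ler_wpM2l (ltW G0) sn)) //.
rewrite -ler_sqr ?nnegrE; last 2 first.
- by rewrite mulr_ge0 // ltW.
- by rewrite !mulr_ge0 ?expR_ge0 ?sqrtr_ge0 // ltW.
apply: le_trans Gs _; rewrite !exprMn !sqr_sqrtr //.
have E2 : E ^+ 2 = expR (- (2 * c2 * n%:R `^ alpha)).
  by rewrite -expRM_natl; congr expR; ring.
have dE : d m <= C0 * E ^+ 2.
  apply: le_trans (dC m m0) _; rewrite ler_pM2l // E2 ler_expR mulNr lerN2.
  rewrite -c2E -[leRHS]mulrA ler_pM2l ?mulr_gt0 // -powRM //.
  by rewrite ge0_ler_powR ?nnegrE ?(ltW alpha_gt0) // -natrM ler_nat.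
have s1 : s 1%N <= 1 by apply: sup_dist_le1 => //; exact: lspan_submod.
have m4 : 4 * m%:R <= 2 * n%:R :> R.
  by rewrite -!natrM ler_nat -[4%N]/(2 * 2)%N -mulnA leq_mul2l mn.
(* C_0 >= 1 allows C_0 to be replaced by C_0^2, as the squared target requires. *)
have sd : s 1%N * d m <= C0 ^+ 2 * E ^+ 2.
  apply: le_trans (_ : 1 * (C0 * E ^+ 2) <= _).
    by apply: ler_pM => //; exact: kolmogorov_width_ge0.
  by rewrite mul1r expr2 ler_wpM2r ?sqr_ge0 // ler_peMr // ltW.
rewrite -mulrA; apply: le_trans (ler_pM _ _ m4 sd) _ => //.
  by rewrite mulr_ge0 // kolmogorov_width_ge0.
by rewrite le_eqVlt; apply/orP; left; apply/eqP; ring.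
Qed.

End GreedyRates.

(** * From distances to X_n to interpolation errors *)

Theorem theorem4p12 (R : realType) (X : completeNormedModType R)
  (N : option nat) (eta : R) (F : set X) (Sigma : set (X -> R^o))
  (Fs : nat -> set X) (Sigmas : nat -> set (X -> R^o))
  (phi : nat -> X) (sigma : nat -> X -> R^o) (C0 alpha c1 : R)
  (N_ge1 : index_le 1 N) (eta_gt0 : 0 < eta) (eta_le1 : eta <= 1)
  (F_compact : compact F) (F_le1 : forall f, F f -> `|f| <= 1)
  (dim_F : dim_gt (lspan F) N)
  (Sigma_dict : dictionary Sigma F)
  (run : geim_run N eta F Sigma Fs Sigmas phi sigma)
  (C0_gt0 : 0 < C0) (alpha_gt0 : 0 < alpha) (c1_gt0 : 0 < c1) :
  let J := geim_interp phi sigma in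
  let Lambda := lebesgue_constant phi sigma in
  let gamma := geim_gamma eta phi sigma in
  let d := kolmogorov_width F in
  ((forall n : nat, (1 <= n)%N -> d n <= C0 * n%:R `^ (- alpha)) ->
   forall n : nat, (1 <= n)%N -> index_le n N -> forall f, F f ->
     `|f - J n f|
       <= (1 + Lambda n) * C0 * beta_alg eta alpha gamma n * n%:R `^ (- alpha))
  /\
  (1 <= C0 ->
   (forall n : nat, (1 <= n)%N -> d n <= C0 * expR (- c1 * n%:R `^ alpha)) ->
   forall n : nat, (1 <= n)%N -> index_le n N -> forall f, F f ->
     let c2 := c1 * 2 `^ (- 2 * alpha - 1) in
     `|f - J n f|
       <= (1 + Lambda n) * C0 * beta_exp eta gamma n
          * expR (- c2 * n%:R `^ alpha)).
Proof.
move=> J Lambda gamma d.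
have N_ge0 : index_le 0 N := index_le_trans (leq0n 1) N_ge1.
have gamma_gt0 n : 0 < gamma n.
  by rewrite divr_gt0 // ltr_wpDr ?opnorm_ge0.
have F_phi n : index_le n N -> F (phi n) := @run_F_phi _ _ _ _ _ _ _ _ _ _ run n.
(* The weak greedy inequality at n = 0, where J_0 = 0 is bounded with constant 0. *)
have phi0 f : F f -> eta * `|f| <= `|phi 0%N|.
  have J0 g : `|J 0%N g| <= 0 * `|g| by rewrite /J geim_interp0 normr0 mul0r.
  move=> Ff; have := run_weak_greedy eta_gt0 F_le1 run N_ge0 J0 Ff.
  by rewrite !geim_interp0 !subr0.
have gammaP n : index_le n N -> gamma n * sup_dist F (geim_space phi n) <=
    dist_to (geim_space phi n) (phi n).
  move=> nN; rewrite mulrC -ler_pdivlMr //; apply: sup_dist_le => [|f Ff].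
    by rewrite divr_ge0 ?(ltW (gamma_gt0 n)) //; apply: dist_to_ge0; exact: lspan_submod.
  rewrite ler_pdivlMr // mulrC.
  exact: (geim_weak_greedy eta_gt0 F_le1 dim_F Sigma_dict run).
have error n b : index_le n N -> sup_dist F (geim_space phi n) <= b ->
    forall f, F f -> `|f - J n f| <= (1 + Lambda n) * b.
  move=> nN sb f Ff.
  apply: le_trans (geim_error_le_dist eta_gt0 F_le1 dim_F Sigma_dict run nN f) _.
  rewrite ler_wpM2l ?addr_ge0 ?opnorm_ge0 //; apply: le_trans sb.
  by apply: dist_to_le_sup => //; exact: lspan_submod.
split=> [dC n n1 nN f Ff|C0_ge1 dC n n1 nN f Ff].
  rewrite -!(mulrA (1 + Lambda n)); apply: error => //.
  exact: (greedy_rate_alg (N := N) eta_gt0).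
have rate : sup_dist F (geim_space phi n) <= _ :=
  greedy_rate_exp eta_gt0 F_le1 N_ge0 F_phi phi0 gamma_gt0 gammaP C0_gt0
    alpha_gt0 c1_gt0 C0_ge1 dC n1 nN.
by have := error n _ nN rate f Ff; rewrite !(mulrA (1 + Lambda n)).
Qed.
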